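(* Let $(M,J,g)$ be an integrable LCK manifold of real dimension $2n+2$, with Lee form $\theta$, anti-Lee form $\eta$, Lee vector field $U$ and anti-Lee vector field $V$, such that the metric is Gauduchon and $|\theta|=1$. Then $$d\eta = n\,\eta\wedge\theta,\qquad [U,V]=n\,V.$$
   Context: All manifolds are smooth of real dimension $2n+2$ with $n\ge 1$. A Hermitian manifold $(M,J,g)$ consists of a $(1,1)$-tensor field $J$ with $J^2=-\mathrm{Id}$ and vanishing Nijenhuis torsion, and a Riemannian metric $g$ with $g(JX,JY)=g(X,Y)$. Its fundamental $2$-form is $\Omega(X,Y)=g(X,JY)$. The codifferential is $\delta=-\sum_k i_{E_k}\nabla_{E_k}$ for a local orthonormal frame $(E_k)$ and the Levi-Civita connection $\nabla$. The anti-Lee $1$-form is $\eta=\frac1n\delta\Omega$ and the Lee $1$-form is $\theta(X)=\eta(JX)$; equivalently $\eta(X)=-\theta(JX)$. The manifold is locally conformal Kähler (LCK) if $d\Omega=\theta\wedge\Omega$ and $d\theta=0$. The Lee and anti-Lee vector fields $U,V$ are the metric duals of $\theta,\eta$: $\theta=g(U,\cdot)$, $\eta=g(V,\cdot)$ (so $V=JU$). An LCK manifold is integrable if $V$ is nowhere zero and the distribution $V^\perp=\ker\eta$ is integrable. The metric is Gauduchon if $\delta\theta=0$. Conventions: $d\eta(X,Y)=X(\eta(Y))-Y(\eta(X))-\eta([X,Y])$, $(\alpha\wedge\beta)(X,Y)=\alpha(X)\beta(Y)-\alpha(Y)\beta(X)$ for $1$-forms, and $(\theta\wedge\Omega)(X,Y,Z)=\theta(X)\Omega(Y,Z)+\theta(Y)\Omega(Z,X)+\theta(Z)\Omega(X,Y)$.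 *)

(* Defs.v *)
From HB Require Import structures.
From mathcomp Require Import all_boot all_order all_algebra.
From mathcomp Require Import all_classical all_reals all_analysis.
Import Order.TTheory GRing.Theory Num.Theory.
Import numFieldNormedType.Exports.

Set Implicit Arguments.
Unset Strict Implicit.
Unset Printing Implicit Defensive.

Local Open Scope classical_set_scope.
Local Open Scope ring_scope.

(** ** Smooth manifolds *)

Definition iter_partial {R : realType} {k : nat}
    (s : seq 'I_k) (f : 'rV[R]_k -> R) : 'rV[R]_k -> R :=
  foldr (fun i h x => 'D_(delta_mx 0 i) h x) f s.

(* C^oo on an open set D: partial derivatives of all orders exist and are
   (Frechet) differentiable at every point of D. *)
Definition smooth_in {R : realType} {k : nat}
    (D : set 'rV[R]_k) (f : 'rV[R]_k -> R) : Prop :=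
  forall (s : seq 'I_k) x, D x -> differentiable (iter_partial s f) x.

Record smoothManifold (R : realType) (m : nat) := SmoothManifold {
  carrier :> topologicalType ;
  chart_index : Type ;
  chart_dom : chart_index -> set carrier ;
  chart : chart_index -> carrier -> 'rV[R]_m ;
  chart_inv : chart_index -> 'rV[R]_m -> carrier ;
  manifold_hausdorff : hausdorff_space carrier ;
  manifold_second_countable : @second_countable carrier ;
  chart_cover : forall p, exists i, chart_dom i p ;
  chart_dom_open : forall i, open (chart_dom i) ;
  chart_img_open : forall i, open (chart i @` chart_dom i) ;
  chart_continuous : forall i p, chart_dom i p ->
    {for p, continuous (chart i)} ;
  chart_inv_continuous : forall i x, (chart i @` chart_dom i) x ->
    {for x, continuous (chart_inv i)} ;
  chartK : forall i p, chart_dom i p -> chart_inv i (chart i p) = p ;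
  chart_transition : forall i j (k : 'I_m),
    smooth_in (chart i @` (chart_dom i `&` chart_dom j))
      (fun x => chart j (chart_inv i x) 0 k)
}.

(* A chosen chart around p. The tangent space at p is identified with R^m
   (row vectors) by means of the coordinate basis of this chart. *)
Definition chart_at {R : realType} {m : nat} {M : smoothManifold R m} (p : M) :
  chart_index M := sval (cid (chart_cover p)).

Definition chart_coord {R : realType} {m : nat} {M : smoothManifold R m}
    (i : chart_index M) (k : 'I_m) : M -> R := fun q => chart i q 0 k.

(* W is meant to be open. *)
Definition smooth_fun {R : realType} {m : nat} {M : smoothManifold R m}
    (W : set M) (f : M -> R) : Prop :=
  forall i, smooth_in (chart i @` (W `&` chart_dom i)) (f \o chart_inv i).

(** ** Vector fields

  A vector field assigns to p an element of the tangent space at p, that is, the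
  row of its components in the coordinate basis of [chart_at p]. As
  [chart_at p] varies with p, smoothness cannot be read off these rows; it is
  tested on the components X(x^k) with respect to every chart. *)

Definition vfield {R : realType} {m : nat} (M : smoothManifold R m) :=
  M -> 'rV[R]_m.

(* The function X(f). *)
Definition act {R : realType} {m : nat} {M : smoothManifold R m}
    (X : vfield M) (f : M -> R) : M -> R :=
  fun p => 'D_(X p) (f \o chart_inv (chart_at p)) (chart (chart_at p) p).

Definition smooth_vf {R : realType} {m : nat} {M : smoothManifold R m}
    (W : set M) (X : vfield M) : Prop :=
  forall i (k : 'I_m), smooth_fun (W `&` chart_dom i) (act X (chart_coord i k)).

(* [X, Y] f = X(Y f) - Y(X f), for f running through the coordinate functions
   of the chart in which tangent vectors at p are expressed. *)
Definition lie_bracket {R : realType} {m : nat} {M : smoothManifold R m}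
    (X Y : vfield M) : vfield M :=
  fun p => \row_k (act X (act Y (chart_coord (chart_at p) k)) p
                   - act Y (act X (chart_coord (chart_at p) k)) p).

(** ** Tensor fields

  Fields of 1-forms are given by columns, fields of bilinear forms and of
  endomorphisms by square matrices, again in the basis attached to
  [chart_at p]; an endomorphism A maps the row v to [v *m A]. *)

Definition ev1 {R : realType} {m : nat} {M : smoothManifold R m}
    (a : M -> 'cV[R]_m) (X : vfield M) : M -> R :=
  fun p => (X p *m a p) 0 0.

Definition ev2 {R : realType} {m : nat} {M : smoothManifold R m}
    (b : M -> 'M[R]_m) (X Y : vfield M) : M -> R :=
  fun p => (X p *m b p *m (Y p)^T) 0 0.

Definition endo {R : realType} {m : nat} {M : smoothManifold R m}
    (A : M -> 'M[R]_m) (X : vfield M) : vfield M :=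
  fun p => X p *m A p.

Definition smooth_form1 {R : realType} {m : nat} {M : smoothManifold R m}
    (a : M -> 'cV[R]_m) : Prop :=
  forall (W : set M) X, open W -> smooth_vf W X -> smooth_fun W (ev1 a X).

Definition smooth_form2 {R : realType} {m : nat} {M : smoothManifold R m}
    (b : M -> 'M[R]_m) : Prop :=
  forall (W : set M) X Y, open W -> smooth_vf W X -> smooth_vf W Y ->
    smooth_fun W (ev2 b X Y).

Definition smooth_endo {R : realType} {m : nat} {M : smoothManifold R m}
    (A : M -> 'M[R]_m) : Prop :=
  forall (W : set M) X, open W -> smooth_vf W X -> smooth_vf W (endo A X).

Definition d1 {R : realType} {m : nat} {M : smoothManifold R m}
    (a : M -> 'cV[R]_m) (X Y : vfield M) : M -> R :=
  fun p => act X (ev1 a Y) p - act Y (ev1 a X) p - ev1 a (lie_bracket X Y) p.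

Definition d2 {R : realType} {m : nat} {M : smoothManifold R m}
    (b : M -> 'M[R]_m) (X Y Z : vfield M) : M -> R :=
  fun p => act X (ev2 b Y Z) p + act Y (ev2 b Z X) p + act Z (ev2 b X Y) p
    - ev2 b (lie_bracket X Y) Z p - ev2 b (lie_bracket Y Z) X p
    - ev2 b (lie_bracket Z X) Y p.

Definition wedge11 {R : realType} {m : nat} {M : smoothManifold R m}
    (a b : M -> 'cV[R]_m) (X Y : vfield M) : M -> R :=
  fun p => ev1 a X p * ev1 b Y p - ev1 a Y p * ev1 b X p.

Definition wedge12 {R : realType} {m : nat} {M : smoothManifold R m}
    (a : M -> 'cV[R]_m) (b : M -> 'M[R]_m) (X Y Z : vfield M) : M -> R :=
  fun p => ev1 a X p * ev2 b Y Z p + ev1 a Y p * ev2 b Z X p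
           + ev1 a Z p * ev2 b X Y p.

(** ** Riemannian metrics and the Levi-Civita connection *)

Definition riemannian_metric {R : realType} {m : nat} {M : smoothManifold R m}
    (g : M -> 'M[R]_m) : Prop :=
  [/\ smooth_form2 g,
      forall p, (g p)^T = g p &
      forall p (v : 'rV[R]_m), v != 0 -> 0 < (v *m g p *m v^T) 0 0].

(* The pointwise norm of a 1-form is that of its metric dual. *)
Definition metric_norm {R : realType} {m : nat} {M : smoothManifold R m}
    (g : M -> 'M[R]_m) (X : vfield M) : M -> R :=
  fun p => Num.sqrt (ev2 g X X p).

(* a = g(A, .) *)
Definition metric_dual {R : realType} {m : nat} {M : smoothManifold R m}
    (g : M -> 'M[R]_m) (a : M -> 'cV[R]_m) (A : vfield M) : Prop :=
  forall p (v : 'rV[R]_m), (v *m a p) 0 0 = (A p *m g p *m v^T) 0 0.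

Definition affine_connection {R : realType} {m : nat} {M : smoothManifold R m}
    (nabla : vfield M -> vfield M -> vfield M) : Prop :=
  forall (W : set M) (X X' Y Y' : vfield M) (f : M -> R), open W ->
    smooth_vf W X -> smooth_vf W X' -> smooth_vf W Y -> smooth_vf W Y' ->
    smooth_fun W f ->
    smooth_vf W (nabla X Y) /\
    forall p, W p ->
      [/\ nabla (fun q => X q + X' q) Y p = nabla X Y p + nabla X' Y p,
          nabla (fun q => f q *: X q) Y p = f p *: nabla X Y p,
          nabla X (fun q => Y q + Y' q) p = nabla X Y p + nabla X Y' p &
          nabla X (fun q => f q *: Y q) p
            = act X f p *: Y p + f p *: nabla X Y p].

Definition levi_civita {R : realType} {m : nat} {M : smoothManifold R m}
    (g : M -> 'M[R]_m) (nabla : vfield M -> vfield M -> vfield M) : Prop :=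
  [/\ affine_connection nabla,
      forall (W : set M) X Y p, open W -> smooth_vf W X -> smooth_vf W Y ->
        W p -> nabla X Y p - nabla Y X p = lie_bracket X Y p &
      forall (W : set M) X Y Z p, open W ->
        smooth_vf W X -> smooth_vf W Y -> smooth_vf W Z -> W p ->
        act X (ev2 g Y Z) p = ev2 g (nabla X Y) Z p + ev2 g Y (nabla X Z) p].

Definition cov1 {R : realType} {m : nat} {M : smoothManifold R m}
    (nabla : vfield M -> vfield M -> vfield M)
    (X : vfield M) (a : M -> 'cV[R]_m) (Y : vfield M) : M -> R :=
  fun p => act X (ev1 a Y) p - ev1 a (nabla X Y) p.

Definition cov2 {R : realType} {m : nat} {M : smoothManifold R m}
    (nabla : vfield M -> vfield M -> vfield M)
    (X : vfield M) (b : M -> 'M[R]_m) (Y Z : vfield M) : M -> R :=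
  fun p => act X (ev2 b Y Z) p - ev2 b (nabla X Y) Z p - ev2 b Y (nabla X Z) p.

Definition orthonormal_frame {R : realType} {m : nat} {M : smoothManifold R m}
    (g : M -> 'M[R]_m) (W : set M) (E : 'I_m -> vfield M) : Prop :=
  (forall k, smooth_vf W (E k)) /\
  (forall p, W p -> forall k l, ev2 g (E k) (E l) p = (k == l)%:R).

(* c = delta a for a 1-form a, computed near every point in a local
   orthonormal frame; the result does not depend on the frame. *)
Definition codiff1 {R : realType} {m : nat} {M : smoothManifold R m}
    (g : M -> 'M[R]_m) (nabla : vfield M -> vfield M -> vfield M)
    (a : M -> 'cV[R]_m) (c : M -> R) : Prop :=
  forall p, exists (W : set M) (E : 'I_m -> vfield M),
    [/\ open W, W p, orthonormal_frame g W E &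
        forall q, W q -> c q = - \sum_k cov1 nabla (E k) a (E k) q].

(* Likewise c = delta b for a 2-form b. *)
Definition codiff2 {R : realType} {m : nat} {M : smoothManifold R m}
    (g : M -> 'M[R]_m) (nabla : vfield M -> vfield M -> vfield M)
    (b : M -> 'M[R]_m) (c : M -> 'cV[R]_m) : Prop :=
  forall p, exists (W : set M) (E : 'I_m -> vfield M),
    [/\ open W, W p, orthonormal_frame g W E &
        forall (O : set M) Y q, open O -> O `<=` W -> smooth_vf O Y -> O q ->
          ev1 c Y q = - \sum_k cov2 nabla (E k) b (E k) Y q].

(** ** Hermitian and locally conformal Kaehler manifolds *)

Definition nijenhuis {R : realType} {m : nat} {M : smoothManifold R m}
    (J : M -> 'M[R]_m) (X Y : vfield M) : vfield M :=
  fun p => lie_bracket (endo J X) (endo J Y) p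
    - endo J (lie_bracket (endo J X) Y) p
    - endo J (lie_bracket X (endo J Y)) p
    - lie_bracket X Y p.

Definition hermitian_structure {R : realType} {m : nat} {M : smoothManifold R m}
    (J g : M -> 'M[R]_m) : Prop :=
  [/\ smooth_endo J,
      forall p, J p *m J p = - 1%:M,
      forall (W : set M) X Y p, open W -> smooth_vf W X -> smooth_vf W Y ->
        W p -> nijenhuis J X Y p = 0,
      riemannian_metric g &
      forall X Y : vfield M, ev2 g (endo J X) (endo J Y) = ev2 g X Y].

(* Omega(X, Y) = g(X, J Y); since J Y is the row Y *m J, this is
   X *m g *m J^T *m Y^T. *)
Definition fundamental_form {R : realType} {m : nat} {M : smoothManifold R m}
    (J g : M -> 'M[R]_m) : M -> 'M[R]_m :=
  fun p => g p *m (J p)^T.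

(* theta(X) = eta(J X) *)
Definition lee_form {R : realType} {m : nat} {M : smoothManifold R m}
    (J : M -> 'M[R]_m) (eta : M -> 'cV[R]_m) : M -> 'cV[R]_m :=
  fun p => J p *m eta p.

(* n eta = delta Omega, the real dimension being 2n + 2. *)
Definition anti_lee_form {R : realType} {n : nat}
    {M : smoothManifold R n.*2.+2} (J g : M -> 'M[R]_(n.*2.+2))
    (nabla : vfield M -> vfield M -> vfield M)
    (eta : M -> 'cV[R]_(n.*2.+2)) : Prop :=
  exists deltaOmega : M -> 'cV[R]_(n.*2.+2),
    [/\ smooth_form1 deltaOmega,
        codiff2 g nabla (fundamental_form J g) deltaOmega &
        forall p, eta p = n%:R^-1 *: deltaOmega p].

Definition lck {R : realType} {m : nat} {M : smoothManifold R m}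
    (J g : M -> 'M[R]_m) (eta : M -> 'cV[R]_m) : Prop :=
  forall (W : set M) X Y Z p, open W ->
    smooth_vf W X -> smooth_vf W Y -> smooth_vf W Z -> W p ->
    d2 (fundamental_form J g) X Y Z p
      = wedge12 (lee_form J eta) (fundamental_form J g) X Y Z p /\
    d1 (lee_form J eta) X Y p = 0.

(* h : D -> M is a smooth map from an open set D of R^k. *)
Definition smooth_param {R : realType} {m k : nat} {M : smoothManifold R m}
    (D : set 'rV[R]_k) (h : 'rV[R]_k -> M) : Prop :=
  [/\ open D, forall s, D s -> {for s, continuous h} &
      forall i (l : 'I_m),
        smooth_in (D `&` h @^-1` chart_dom i) (chart_coord i l \o h)].

(* The differential of h at s, with values in the tangent space at h s. *)
Definition param_diff {R : realType} {m k : nat} {M : smoothManifold R m}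
    (h : 'rV[R]_k -> M) (s a : 'rV[R]_k) : 'rV[R]_m :=
  'D_a (chart (chart_at (h s)) \o h) s.

(* Through every point passes an integral manifold of the distribution ker a,
   that is, an immersed submanifold with tangent spaces equal to ker a; for a
   without zeros these are hypersurfaces. *)
Definition integrable_kernel {R : realType} {m : nat}
    {M : smoothManifold R m.+1} (a : M -> 'cV[R]_(m.+1)) : Prop :=
  forall p : M, exists (D : set 'rV[R]_m) (h : 'rV[R]_m -> M) (s0 : 'rV[R]_m),
    [/\ smooth_param D h, D s0, h s0 = p,
        forall s, D s -> injective (param_diff h s) &
        forall s, D s -> forall w : 'rV[R]_(m.+1),
          (exists v, param_diff h s v = w) <-> (w *m a (h s)) 0 0 = 0].

(* Main.v *)
Require Import Defs.
From HB Require Import structures.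
From mathcomp Require Import all_boot all_order all_algebra.
From mathcomp Require Import all_classical all_reals all_analysis.
From mathcomp Require Import ring lra.
Import Order.TTheory GRing.Theory Num.Theory.
Import numFieldNormedType.Exports.
Local Open Scope classical_set_scope.
Local Open Scope ring_scope.

(** Write K for d eta at a point p. Three facts determine K up to a factor.
    - K is J-invariant: theta = eta o J is closed and J has no torsion, so that
      the formula for d eta (J X, J Y) reduces to the one for d eta (X, Y)
      ([d1_eta_J]).
    - K vanishes on ker eta: eta pulls back to 0 on an integral hypersurface,
      hence so does d eta ([integrable_kernel_d1], which rests on the symmetry
      of second derivatives, [derive_comm]).
    - A J-invariant 2-form that vanishes on ker eta pairs V with U only: J
      maps V to - U and preserves the orthogonal complement of both, so that
      K(V, X) = - K(U, J X) = 0 for X in this complement. Hence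
      K = c (eta /\ theta) ([invariant_form_kernel]).

    The factor c is read off from a trace. As Omega(., V) = - theta, evaluating
    n eta = delta Omega on V gives
      n = tr (nabla theta) - sum_k (nabla_(E_k) eta)(J E_k)
    ([codiff2_Omega_V]). The first term is - delta theta = 0. The second sum is
    one half of sum_k K(E_k, J E_k), which for K = c (eta /\ theta) equals - 2 c
    ([trace_skew], [trace_dual_plane]). Hence c = n.

    For the bracket, evaluate d Omega = theta /\ Omega on U, V and Z. The right
    side is theta(Z) - theta(Z) = 0. On the left side, Omega(V, .) = theta and
    Omega(., U) = eta turn all terms but Omega([U, V], Z) into those of
    d theta (Z, U) = 0 and of d eta (V, Z) = n theta(Z). Hence
    Omega([U, V], Z) = n theta(Z) = Omega(n V, Z) for all Z
    ([lie_bracket_UV]), and Omega is nondegenerate.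

    The traces delta theta and delta Omega are taken in local frames that need
    not agree, and K is used as a bilinear form on a single tangent space. This requires that
    (nabla_X a)(Y) at p depends on the values X p and Y p alone ([cov1E]).
    The connection acts on globally defined fields of which only the
    restriction to an open set is smooth; its locality ([nabla_local]) comes
    from the indicator function of that set, which is smooth there. *)

(** * Differentiability and smoothness on open subsets of R^k *)

(** The difference of two functions that agree near x has derivative 0 at x. *)
Lemma near_eq_differentiable {R : numFieldType} {V W : normedModType R}
    (f g : V -> W) (x : V) :
  {near x, f =1 g} -> differentiable f x -> differentiable g x.
Proof.
move=> fg df.
have gf : (g \- f) \o shift x = cst ((g \- f) x) + 0 +o_ 0 id.
  apply/eqaddoP => _/posnumP[e]; near=> y.
  have gy : f (y + x) = g (y + x).
    near: y; have : \forall z \near x, f z = g z by [].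
    by rewrite (near_shift 0) subr0.
  change (`|g (y + x) - f (y + x) - (g x - f x + 0)| <= e%:num * `|y|).
  by rewrite gy (nbhs_singleton fg) !subrr addr0 subrr normr0 mulr_ge0.
have dgf : 'd (g \- f) x = 0 :> (V -> W).
  by rewrite -[RHS]/(\0 : V -> W); apply: (diff_unique _ gf) => ?; exact: cvg_cst.
have -> : g = f + (g \- f) by apply/funext => y; rewrite !fctE addrC subrK.
apply: differentiableD => //; apply/diff_locallyP; rewrite dgf; split=> //.
by move=> ?; exact: cvg_cst.
Unshelve. all: by end_near. Qed.

Section smooth_functions.
Context {R : realType} {k : nat}.
Implicit Types (D : set 'rV[R]_k) (f g : 'rV[R]_k -> R).

Lemma open_near_eq {W : Type} {D} {f g : 'rV[R]_k -> W} {x} :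
  open D -> D x -> {in D, f =1 g} -> {near x, f =1 g}.
Proof.
move=> oD Dx fg; have := open_nbhs_nbhs (conj oD Dx).
by apply: filterS => y Dy; apply: fg; rewrite inE.
Qed.

(** Smoothness counted by the number of derivatives. Unlike [smooth_in], this
    recursion puts the new partial derivative innermost, next to f, where the
    product and chain rules apply; the stability proofs are then inductions on
    the order, for all functions at once. *)
Fixpoint diff_upto D (n : nat) f : Prop :=
  (forall x, D x -> differentiable f x) /\
  if n is n'.+1 then forall i, diff_upto D n' ('D_(delta_mx 0 i) f) else True.

Lemma diff_uptoW {D n f} : diff_upto D n f -> forall x, D x -> differentiable f x.
Proof. by case: n => [|n] []. Qed.

Lemma diff_uptoS {D n f} : diff_upto D n.+1 f -> diff_upto D n f.
Proof.
elim: n f => [|n IHn] f [df ddf]; split=> // i.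
by apply: IHn; exact: ddf.
Qed.

Lemma smooth_inP D f : smooth_in D f <-> forall n, diff_upto D n f.
Proof.
split=> [sf n|df s].
  elim: n f sf => [|n IHn] f sf; split=> //; try by move=> x; exact: (sf [::]).
  move=> i; apply: IHn => s x Dx.
  by have := sf (rcons s i) x Dx; rewrite /iter_partial foldr_rcons.
have {df} := df (size s); elim/last_ind: s f => [|s i IHs] f.
  by move=> /diff_uptoW df x; exact: df.
rewrite size_rcons => -[_ ddf]; rewrite /iter_partial foldr_rcons.
by apply: IHs; exact: ddf.
Qed.

Lemma diff_upto_eq {D n f g} : open D -> {in D, f =1 g} ->
  diff_upto D n f -> diff_upto D n g.
Proof.
move=> oD; have near_fg f' g' x : D x -> {in D, f' =1 g'} -> {near x, f' =1 g'}.
  exact: open_near_eq.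
elim: n f g => [|n IHn] f g fg [df ddf]; split=> //.
- by move=> x Dx; apply: near_eq_differentiable (df x Dx); exact: near_fg.
- by move=> x Dx; apply: near_eq_differentiable (df x Dx); exact: near_fg.
move=> i; apply: IHn (ddf i) => x; rewrite inE => Dx.
by apply: near_eq_derive; exact: near_fg.
Qed.

Lemma diff_upto_cst D n (c : R) : diff_upto D n (cst c).
Proof.
elim: n c => [|n IHn] c; split=> // i.
rewrite (_ : 'D__ _ = cst 0) //.
by apply/funext => x; rewrite derive_cst.
Qed.

Lemma diff_uptoD {D n f g} : open D ->
  diff_upto D n f -> diff_upto D n g -> diff_upto D n (f \+ g).
Proof.
move=> oD; elim: n f g => [|n IHn] f g [df ddf] [dg ddg]; split=> //;
  try by move=> x Dx; apply: differentiableD; [exact: df|exact: dg].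
move=> i; apply: diff_upto_eq oD _ (IHn _ _ (ddf i) (ddg i)) => x.
by rewrite inE => Dx; rewrite /= deriveD //; apply: diff_derivable; auto.
Qed.

Lemma diff_uptoM {D n f g} : open D ->
  diff_upto D n f -> diff_upto D n g -> diff_upto D n (f \* g).
Proof.
move=> oD; elim: n f g => [|n IHn] f g nf ng; split=> //;
  try by move=> x Dx; apply: differentiableM;
         [exact: (diff_uptoW nf)|exact: (diff_uptoW ng)].
move=> i; case: (nf) (ng) => df ddf [dg ddg].
have := diff_uptoD oD (IHn _ _ (diff_uptoS nf) (ddg i))
                      (IHn _ _ (ddf i) (diff_uptoS ng)).
apply: diff_upto_eq => // x; rewrite inE => Dx /=.
rewrite [RHS]deriveM; try by apply: diff_derivable; auto.
by rewrite /GRing.scale /= [g x * _]mulrC.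
Qed.

Lemma diff_upto_sum {D n} {I : Type} (r : seq I) (F : I -> 'rV[R]_k -> R) :
  open D -> (forall i, diff_upto D n (F i)) ->
  diff_upto D n (fun x => \sum_(i <- r) F i x).
Proof.
move=> oD dF; elim: r => [|i r IHr].
  by under eq_fun do rewrite big_nil; exact: diff_upto_cst.
by under eq_fun do rewrite big_cons; exact: diff_uptoD.
Qed.

End smooth_functions.

Lemma differentiable_rowP {R : realType} {V : normedModType R} {k : nat}
    (phi : V -> 'rV[R]_k) (x : V) :
  (forall l, differentiable (fun y => phi y 0 l) x) -> differentiable phi x.
Proof.
move=> dphi.
have -> : phi = \sum_(l < k) (fun y => phi y 0 l *: delta_mx 0 l).
  by apply/funext => y; rewrite fct_sumE {1}[phi y]row_sum_delta.
by apply: differentiable_sum => l; exact: differentiableZl.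
Qed.

Lemma derive_linear {R : realType} {V W : normedModType R} (f : V -> W) x
    (a : R) (u v : V) : differentiable f x ->
  'D_(a *: u + v) f x = a *: 'D_u f x + 'D_v f x.
Proof. by move=> df; rewrite !deriveE // linearP. Qed.

Lemma derive_comp {R : realType} {U V W : normedModType R} (phi : U -> V)
    (f : V -> W) x v : differentiable phi x -> differentiable f (phi x) ->
  'D_v (f \o phi) x = 'D_('D_v phi x) f (phi x).
Proof.
move=> dphi df; rewrite (deriveE _ (differentiable_comp dphi df)) diff_comp //.
by rewrite (deriveE _ df) (deriveE _ dphi).
Qed.

Lemma derive_row {R : realType} {V : normedModType R} {k : nat}
    (phi : V -> 'rV[R]_k) (x v : V) (l : 'I_k) : differentiable phi x ->
  'D_v phi x 0 l = 'D_v (fun y => phi y 0 l) x.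
Proof. by move=> dphi; rewrite derive_mx ?mxE//; exact: diff_derivable. Qed.

Lemma derive_sum_delta {R : realType} {W : normedModType R} {k : nat}
    (f : 'rV[R]_k -> W) (x v : 'rV[R]_k) : differentiable f x ->
  'D_v f x = \sum_(l < k) v 0 l *: 'D_(delta_mx 0 l) f x.
Proof.
move=> df; rewrite {1}[v]row_sum_delta deriveE // linear_sum.
by apply: eq_bigr => l _; rewrite linearZ deriveE.
Qed.

(** The partial derivatives of f o phi are sums of products of those of phi with
    compositions (partial f) o phi of lower order. *)
Lemma diff_upto_comp {R : realType} {k l n : nat} {D : set 'rV[R]_k}
    {D' : set 'rV[R]_l} (phi : 'rV[R]_k -> 'rV[R]_l) (f : 'rV[R]_l -> R) :
  open D -> D `<=` phi @^-1` D' ->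
  (forall j, diff_upto D n (fun x => phi x 0 j)) ->
  diff_upto D' n f -> diff_upto D n (f \o phi).
Proof.
move=> oD DD'; have dphi x m : D x ->
    (forall j, diff_upto D m (fun x => phi x 0 j)) -> differentiable phi x.
  by move=> Dx nphi; apply: differentiable_rowP => j; exact: (diff_uptoW (nphi j)).
elim: n f => [|n IHn] f nphi nf; split=> //;
  try by move=> x Dx; apply: differentiable_comp;
    [exact: dphi Dx nphi|apply: (diff_uptoW nf); exact: DD'].
move=> i; case: (nf) => df ddf.
pose F j := 'D_(delta_mx 0 i) (fun y => phi y 0 j) \* ('D_(delta_mx 0 j) f \o phi).
have nF j : diff_upto D n (F j).
  apply: diff_uptoM => //; first by case: (nphi j) => _ /(_ i).
  by apply: IHn (ddf j) => j'; exact: diff_uptoS (nphi j').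
apply: diff_upto_eq oD _ (diff_upto_sum (index_enum _) F oD nF) => x.
rewrite inE => Dx; rewrite derive_comp; [|exact: dphi Dx nphi|by apply: df; exact: DD'].
rewrite [RHS]derive_sum_delta; last by apply: df; exact: DD'.
by apply: eq_bigr => j _; rewrite derive_row //; exact: dphi Dx nphi.
Qed.

Section smooth_in_theory.
Context {R : realType} {k : nat}.
Implicit Types (D : set 'rV[R]_k) (f g : 'rV[R]_k -> R).

Lemma smooth_in_diff {D f x} : smooth_in D f -> D x -> differentiable f x.
Proof. by move=> sf Dx; exact: (sf [::]). Qed.

Lemma smooth_in_partial {D f} i : smooth_in D f ->
  smooth_in D ('D_(delta_mx 0 i) f).
Proof. by move=> /smooth_inP sf; apply/smooth_inP => n; case: (sf n.+1) => _ /(_ i). Qed.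

Lemma smooth_in_sub {D D' f} : D' `<=` D -> smooth_in D f -> smooth_in D' f.
Proof. by move=> D'D sf s x D'x; apply: sf; exact: D'D. Qed.

Lemma smooth_in_eq {D f g} : open D -> {in D, f =1 g} ->
  smooth_in D f -> smooth_in D g.
Proof.
move=> oD fg /smooth_inP sf; apply/smooth_inP => n; exact: diff_upto_eq fg (sf n).
Qed.

Lemma smooth_in_cst D (c : R) : smooth_in D (cst c).
Proof. by apply/smooth_inP => n; exact: diff_upto_cst. Qed.

Lemma smooth_inD {D f g} : open D ->
  smooth_in D f -> smooth_in D g -> smooth_in D (f \+ g).
Proof.
by move=> oD /smooth_inP sf /smooth_inP sg; apply/smooth_inP => n; exact: diff_uptoD.
Qed.

Lemma smooth_inM {D f g} : open D ->
  smooth_in D f -> smooth_in D g -> smooth_in D (f \* g).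
Proof.
by move=> oD /smooth_inP sf /smooth_inP sg; apply/smooth_inP => n; exact: diff_uptoM.
Qed.

Lemma smooth_in_comp {l} {D} {D' : set 'rV[R]_l} (phi : 'rV[R]_k -> 'rV[R]_l)
    (f : 'rV[R]_l -> R) :
  open D -> D `<=` phi @^-1` D' ->
  (forall j, smooth_in D (fun x => phi x 0 j)) ->
  smooth_in D' f -> smooth_in D (f \o phi).
Proof.
move=> oD DD' sphi /smooth_inP sf; apply/smooth_inP => n.
by apply: diff_upto_comp (sf n) => // j; have /smooth_inP := sphi j.
Qed.

End smooth_in_theory.

(** * Symmetry of second derivatives *)

Section schwarz.
Context {R : realType} {V : normedModType R}.
Implicit Types (f : V -> R) (x u v : V).

Lemma is_derive_line f x u (s : R) : differentiable f (s *: u + x) ->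
  is_derive s 1 (fun s' => f (s' *: u + x)) ('D_u f (s *: u + x)).
Proof.
move=> df; pose phi (s' : R) := s' *: u + x.
have dphi : is_diff s phi ( *:%R^~ u).
  have -> : phi = ( *:%R^~ u) \+ cst x by apply/funext.
  apply: is_diff_eq; exact: addr0.
have phi_u : 'D_1 phi s = u by rewrite deriveE // diff_val scale1r.
apply: DeriveDef; first by apply/diff_derivable/(@differentiable_comp _ _ _ _ phi f).
by rewrite (@derive_comp _ _ _ _ phi f) // phi_u.
Qed.

(** Symmetric in u and v, so that a limit computed in one order also is the
    limit computed in the other. *)
Definition second_diff f x u v (t : R) : R :=
  f (t *: u + (t *: v + x)) - f (t *: u + x) - f (t *: v + x) + f x.

(** By the mean value theorem in the direction u, the second difference is t
    times an increment of D_u f over t v. The differential of D_u f at x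
    evaluates this increment up to o(t). *)
Lemma second_diff_approx f x u v (e : R) :
  (\forall y \near x, differentiable f y) -> differentiable ('D_u f) x -> 0 < e ->
  \forall t \near 0^'+,
    `|second_diff f x u v t - t ^+ 2 * 'D_v ('D_u f) x| <= e * t ^+ 2.
Proof.
move=> nf df e0.
(* c bounds the total length, over t, of the two increments from x along which
   the expansion of D_u f is used; the summand 1 keeps it positive. *)
pose c := 2 * (`|u| + `|v|) + 1.
have c0 : 0 < c by rewrite ltr_wpDl // mulr_ge0 // addr_ge0.
have ec0 : 0 < e / c by rewrite divr_gt0.
have /eqaddoP/(_ _ ec0) := diff_locally df.
have : \forall h \near 0, differentiable f (h + x).
  by move: nf; rewrite (near_shift 0) subr0.
move=> nf0 ng0; have [d /= d0 hd] : exists2 d : R, 0 < d & forall h, `|h| < d ->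
    differentiable f (h + x) /\
    `|'D_u f (h + x) - ('D_u f x + 'd ('D_u f) x h)| <= e / c * `|h|.
  by have [d d0 hd] := iffLR nbhs_norm0P (filterI nf0 ng0); exists d.
near=> t.
have t0 : 0 < t by near: t; exact: nbhs_right_gt.
have tc : t * c < d.
  by rewrite -ltr_pdivlMr //; near: t; apply: nbhs_right_lt; rewrite divr_gt0.
have small (s r : R) : 0 <= s <= t -> 0 <= r <= t -> `|s *: u + r *: v| <= t * (`|u| + `|v|).
  move=> /andP[s0 st] /andP[r0 rt]; rewrite (le_trans (ler_normD _ _)) // !normrZ.
  by rewrite mulrDr lerD // ler_wpM2r // ger0_norm.
have uvc : t * (`|u| + `|v|) < d.
  rewrite (le_lt_trans _ tc) // ler_wpM2l ?ltW // /c.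
  by have := normr_ge0 u; have := normr_ge0 v; lra.
have at_pt (s r : R) : 0 <= s <= t -> 0 <= r <= t ->
    differentiable f (s *: u + r *: v + x) /\
    `|'D_u f (s *: u + r *: v + x) - ('D_u f x + 'd ('D_u f) x (s *: u + r *: v))|
      <= e / c * `|s *: u + r *: v|.
  by move=> hs hr; apply: (hd (s *: u + r *: v)); exact: le_lt_trans (small _ _ hs hr) uvc.
have tt : 0 <= t <= t by rewrite lexx ltW.
have oo : 0 <= (0 : R) <= t by rewrite lexx ltW.
pose phi (s : R) := f (s *: u + (t *: v + x)) - f (s *: u + x).
pose dphi (s : R) : R := 'D_u f (s *: u + (t *: v + x)) - 'D_u f (s *: u + x).
have phiP (s : R) : 0 <= s <= t -> is_derive s 1 phi (dphi s).
  move=> hs; have [d1 _] := at_pt s t hs tt; have [d2 _] := at_pt s 0 hs oo.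
  apply: is_deriveB; apply: is_derive_line; first by rewrite addrA.
  by rewrite scale0r addr0 in d2.
(* s is the intermediate point given by the mean value theorem for phi, whose
   increment over [0, t] is the second difference. *)
have [||s] := @MVT _ phi dphi 0 t t0.
- move=> s; rewrite in_itv /= => /andP[s0 st].
  by apply: phiP; rewrite !ltW.
- apply: derivable_within_continuous => s; rewrite in_itv /= => /phiP[//].
rewrite in_itv /= subr0 => /andP[/ltW s0 /ltW st] phi_s.
have hs : 0 <= s <= t by rewrite s0.
have -> : second_diff f x u v t = dphi s * t.
  by rewrite -phi_s /second_diff /phi !scale0r !add0r; ring.
have [_ ap1] := at_pt s t hs tt; have [_ ap2] := at_pt s 0 hs oo.
have := ler_wpM2l (ltW ec0) (small s t hs tt).
have := ler_wpM2l (ltW ec0) (small s 0 hs oo).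
move: ap1 ap2; set N1 := `|s *: u + t *: v|; set N2 := `|s *: u + 0 *: v|.
have L (r : R) : 'd ('D_u f) x (s *: u + r *: v)
    = s * 'D_u ('D_u f) x + r * 'D_v ('D_u f) x.
  by rewrite linearD !linearZ !(deriveE _ df).
rewrite !{}L !scale0r addr0 mul0r addr0 -addrA => ap1 ap2 n2 n1.
have bound : `|dphi s - t * 'D_v ('D_u f) x| <= e * t.
  have -> : dphi s - t * 'D_v ('D_u f) x =
      ('D_u f (s *: u + (t *: v + x))
       - ('D_u f x + (s * 'D_u ('D_u f) x + t * 'D_v ('D_u f) x)))
      - ('D_u f (s *: u + x) - ('D_u f x + s * 'D_u ('D_u f) x)).
    rewrite /dphi; move: ('D_u f (s *: u + _)) ('D_u f (s *: u + x)).
    by move: ('D_u f x) ('D_u _ x) ('D_v _ x) => *; ring.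
  apply: le_trans (ler_normB _ _) _.
  apply: (@le_trans _ _ (e / c * (t * c))); last first.
    by rewrite mulrACA mulVf ?gt_eqF // mulr1.
  apply: le_trans (lerD ap1 ap2) _; apply: le_trans (lerD n1 n2) _.
  by rewrite -mulrDr ler_pM2l // -mulrDr ler_pM2l // /c mulr_natl mulr2n lerDl.
have -> : dphi s * t - t ^+ 2 * 'D_v ('D_u f) x
    = (dphi s - t * 'D_v ('D_u f) x) * t.
  by move: (dphi s) ('D_v _ x) => *; ring.
by rewrite normrM (ger0_norm (ltW t0)) expr2 mulrA ler_wpM2r // ltW.
Unshelve. all: by end_near. Qed.

Lemma derive_comm f x u v : (\forall y \near x, differentiable f y) ->
  differentiable ('D_u f) x -> differentiable ('D_v f) x ->
  'D_v ('D_u f) x = 'D_u ('D_v f) x.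
Proof.
move=> nf du dv; apply/eqP; rewrite -subr_eq0 -normr_eq0 eq_le normr_ge0 andbT.
apply/ler_addgt0Pr => e e0; rewrite add0r; have e20 : 0 < e / 2 by rewrite divr_gt0.
have nuv := second_diff_approx _ _ _ v _ nf du e20.
have nvu := second_diff_approx _ _ _ u _ nf dv e20.
have [t [[h_nuv h_nvu] t0]] :=
  @filter_ex _ ((0 : R)^'+) _ _ (filterI (filterI nuv nvu) (nbhs_right_gt (0 : R))).
have sym : second_diff f x v u t = second_diff f x u v t.
  rewrite /second_diff addrCA.
  by move: (f _) (f _) (f _) (f _) => *; ring.
rewrite /= {}sym in h_nvu; rewrite /= in h_nuv t0.
have {}t0 : 0 < t by [].
have t20 : 0 < t ^+ 2 by rewrite exprn_gt0.
rewrite -(ler_pM2r t20) [e]splitr mulrDl; apply: le_trans (lerD h_nvu h_nuv).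
rewrite -{1}(ger0_norm (ltW t20)) -normrM; apply: le_trans (ler_normB _ _).
move: (second_diff _ _ _ _ _) ('D_v _ x) ('D_u _ x) => *.
by rewrite le_eqVlt; apply/orP; left; apply/eqP; congr `|_|; ring.
Qed.

End schwarz.

(** * Derivations, smooth functions and vector fields on a manifold *)

Section manifold_calculus.
Context {R : realType} {m : nat} {M : smoothManifold R m}.
Implicit Types (p q : M) (W : set M) (f h : M -> R) (X Y : vfield M)
  (i j : chart_index M).

Lemma chart_atP p : chart_dom (chart_at p) p.
Proof. exact: (svalP (cid (chart_cover p))). Qed.

Lemma open_chart_image i {W} : open W -> open (chart i @` (W `&` chart_dom i)).
Proof.
move=> oW; rewrite openE => x [p [Wp ip] <-{x}].
have img : (chart i @` chart_dom i) (chart i p) by exists p.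
have Wn : nbhs (chart_inv i (chart i p)) W.
  by rewrite chartK //; exact: open_nbhs_nbhs.
have Wi : nbhs (chart i p) (chart_inv i @^-1` W) := chart_inv_continuous img Wn.
have In := open_nbhs_nbhs (conj (@chart_img_open _ _ M i) img).
apply: filterS (filterI Wi In) => y [Wy [q iq qy]]; exists q => //; split=> //.
by move: Wy; rewrite /= -qy chartK.
Qed.

Lemma near_transition {T : Type} i j p (f : M -> T) : chart_dom i p -> chart_dom j p ->
  {near chart i p, (f \o chart_inv j) \o (chart j \o chart_inv i) =1 f \o chart_inv i}.
Proof.
move=> ip jp; apply: (@open_near_eq _ _ _ (chart i @` (chart_dom j `&` chart_dom i))).
- exact/open_chart_image/(@chart_dom_open _ _ M).
- by exists p.
- by move=> x; rewrite inE => -[q [jq iq] <-] /=; rewrite chartK // chartK.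
Qed.

Lemma differentiable_transition i j p : chart_dom i p -> chart_dom j p ->
  differentiable (chart j \o chart_inv i) (chart i p).
Proof.
move=> ip jp; apply: differentiable_rowP => k.
by apply: (smooth_in_diff (@chart_transition _ _ M i j k)); exists p.
Qed.

(** Differentiability at p is tested in the chart that [act] uses at p;
    [mdiff_chart] carries it over to the other charts. *)
Definition mdiff f p := differentiable (f \o chart_inv (chart_at p)) (chart (chart_at p) p).

Lemma mdiff_chart {i f p} : chart_dom i p -> mdiff f p ->
  differentiable (f \o chart_inv i) (chart i p).
Proof.
move=> ip df; apply: near_eq_differentiable (near_transition _ (chart_at p) _ _ ip (chart_atP p)) _.
apply: differentiable_comp; first exact: differentiable_transition ip (chart_atP p).
by rewrite /= chartK.
Qed.

Lemma smooth_mdiff {W f p} : smooth_fun W f -> W p -> mdiff f p.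
Proof.
move=> sf Wp; apply: (smooth_in_diff (sf (chart_at p))).
by exists p => //; split=> //; exact: chart_atP.
Qed.

Lemma act_coord_vec i X p : chart_dom i p ->
  'D_(X p) (chart i \o chart_inv (chart_at p)) (chart (chart_at p) p)
    = \row_k act X (chart_coord i k) p.
Proof.
move=> ip; apply/rowP => k; rewrite mxE derive_row //.
exact: differentiable_transition (chart_atP p) ip.
Qed.

Lemma act_eq {W} f h X p : open W -> W p -> {in W, f =1 h} -> act X f p = act X h p.
Proof.
move=> oW Wp fh; apply: near_eq_derive.
apply: (@open_near_eq _ _ _ (chart (chart_at p) @` (W `&` chart_dom (chart_at p)))).
- exact: open_chart_image.
- by exists p => //; split=> //; exact: chart_atP.
- by move=> x; rewrite inE => -[q [Wq iq] <-] /=; rewrite chartK // fh // inE.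
Qed.

Lemma act_cst (c : R) X p : act X (cst c) p = 0.
Proof. exact: derive_cst. Qed.

Lemma actD f h X p : mdiff f p -> mdiff h p ->
  act X (fun q => f q + h q) p = act X f p + act X h p.
Proof. by move=> df dh; apply: deriveD; exact: diff_derivable. Qed.

Lemma actN f X p : mdiff f p -> act X (fun q => - f q) p = - act X f p.
Proof. by move=> df; apply: deriveN; exact: diff_derivable. Qed.

Lemma actM f h X p : mdiff f p -> mdiff h p ->
  act X (fun q => f q * h q) p = act X f p * h p + f p * act X h p.
Proof.
move=> df dh; rewrite [LHS]deriveM; try exact: diff_derivable.
by rewrite addrC /= chartK ?[h p *: _]mulrC //; exact: chart_atP.
Qed.

(** Stated for one vector Z p, so that it applies to a pointwise sum or
    multiple however the field Z is written. *)
Lemma act_linear f X Y (a : R) (Z : vfield M) p : mdiff f p ->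
  Z p = a *: X p + Y p -> act Z f p = a * act X f p + act Y f p.
Proof. by move=> df Zp; rewrite /act Zp derive_linear. Qed.

Lemma mdiffM f h p : mdiff f p -> mdiff h p -> mdiff (fun q => f q * h q) p.
Proof. by move=> df dh; exact: differentiableM. Qed.

Lemma smooth_fun_eq {W f h} : open W -> {in W, f =1 h} ->
  smooth_fun W f -> smooth_fun W h.
Proof.
move=> oW fh sf i; apply: smooth_in_eq (open_chart_image i oW) _ (sf i) => x.
by rewrite inE => -[q [Wq iq] <-] /=; rewrite chartK // fh // inE.
Qed.

Lemma smooth_fun_sub {W W' f} : W' `<=` W -> smooth_fun W f -> smooth_fun W' f.
Proof.
by move=> W'W sf i; apply: smooth_in_sub (sf i); apply: image_subset; exact: setSI.
Qed.

Lemma smooth_fun_cst W (c : R) : smooth_fun W (cst c).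
Proof. by move=> i; exact: smooth_in_cst. Qed.

Lemma smooth_funD W f h : open W -> smooth_fun W f -> smooth_fun W h ->
  smooth_fun W (fun q => f q + h q).
Proof. by move=> oW sf sh i; apply: smooth_inD => //; exact: open_chart_image. Qed.

Lemma smooth_funM W f h : open W -> smooth_fun W f -> smooth_fun W h ->
  smooth_fun W (fun q => f q * h q).
Proof. by move=> oW sf sh i; apply: smooth_inM => //; exact: open_chart_image. Qed.

Lemma smooth_chart_coord i k : smooth_fun (chart_dom i) (chart_coord i k).
Proof. by move=> j; rewrite setIC; exact: chart_transition. Qed.

Lemma smooth_vf_sub {W W' X} : W' `<=` W -> smooth_vf W X -> smooth_vf W' X.
Proof. by move=> W'W sX i k; apply: smooth_fun_sub (sX i k); exact: setSI. Qed.

Lemma smooth_vf_eq {W X Y} : open W -> {in W, X =1 Y} ->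
  smooth_vf W X -> smooth_vf W Y.
Proof.
move=> oW XY sX i k; apply: smooth_fun_eq (sX i k).
  exact: openI oW (@chart_dom_open _ _ M i).
by move=> q; rewrite inE => -[Wq _]; rewrite /act XY // inE.
Qed.

Lemma smooth_vfD W X Y : open W -> smooth_vf W X -> smooth_vf W Y ->
  smooth_vf W (fun q => X q + Y q).
Proof.
move=> oW sX sY i k; have oWi := openI oW (@chart_dom_open _ _ M i).
apply: smooth_fun_eq (smooth_funD _ _ _ oWi (sX i k) (sY i k)) => // q.
rewrite inE => -[Wq iq]; rewrite [RHS](act_linear _ X Y 1) ?mul1r ?scale1r //.
exact: smooth_mdiff (smooth_chart_coord i k) iq.
Qed.

Lemma smooth_vf0 W : smooth_vf W (fun=> 0).
Proof.
move=> i k; rewrite (_ : act _ _ = cst 0); first exact: smooth_fun_cst.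
by apply/funext => q; rewrite /act derive0.
Qed.

Lemma smooth_vfZ W f X : open W -> smooth_fun W f -> smooth_vf W X ->
  smooth_vf W (fun q => f q *: X q).
Proof.
move=> oW sf sX i k; have oWi := openI oW (@chart_dom_open _ _ M i).
have sfi : smooth_fun (W `&` chart_dom i) f by apply: smooth_fun_sub sf => q [].
apply: smooth_fun_eq (smooth_funM _ _ _ oWi sfi (sX i k)) => // q.
rewrite inE => -[Wq iq]; rewrite [RHS](act_linear _ X (fun=> 0) (f q)) ?addr0 //.
  by rewrite [act (fun=> 0) _ _]derive0 addr0.
exact: smooth_mdiff (smooth_chart_coord i k) iq.
Qed.

Lemma smooth_vf_sum {I : Type} (r : seq I) W (F : I -> vfield M) : open W ->
  (forall k, smooth_vf W (F k)) -> smooth_vf W (fun q => \sum_(k <- r) F k q).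
Proof.
move=> oW sF; elim: r => [|k r IHr].
  by under eq_fun do rewrite big_nil; exact: smooth_vf0.
by under eq_fun do rewrite big_cons; exact: smooth_vfD.
Qed.

(** The coordinate field d/dx^l of the chart i. Its value at q has to be
    expressed in the basis of the chart chosen at q, whence the derivative of
    the transition map. *)
Definition coord_vf i (l : 'I_m) : vfield M :=
  fun q => 'D_(delta_mx 0 l) (chart (chart_at q) \o chart_inv i) (chart i q).

Lemma act_coord_vf i l f q : chart_dom i q -> mdiff f q ->
  act (coord_vf i l) f q = 'D_(delta_mx 0 l) (f \o chart_inv i) (chart i q).
Proof.
move=> iq df; have jq := chart_atP q.
rewrite -(near_eq_derive _ (near_transition _ (chart_at q) _ f iq jq)).
rewrite derive_comp; first by rewrite /= chartK.
  exact: differentiable_transition.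
by rewrite /= chartK.
Qed.

Lemma coord_vf_at p l : coord_vf (chart_at p) l p = delta_mx 0 l.
Proof.
have ip := chart_atP p; rewrite /coord_vf.
rewrite -[RHS](derive_id (chart (chart_at p) p)); apply: near_eq_derive.
apply: (@open_near_eq _ _ _ (chart (chart_at p) @` chart_dom (chart_at p))).
- exact: (@chart_img_open _ _ M).
- by exists p.
- by move=> x; rewrite inE => -[q iq <-] /=; rewrite chartK.
Qed.

(** The components of d/dx^l in a chart j are partial derivatives of the
    transition map from i to j, read through a further chart i'. *)
Lemma smooth_coord_vf i l : smooth_vf (chart_dom i) (coord_vf i l).
Proof.
move=> j k i'; have oI : open (chart_dom i `&` chart_dom j).
  exact: openI (@chart_dom_open _ _ M i) (@chart_dom_open _ _ M j).
have sx : smooth_in (chart i @` (chart_dom i `&` chart_dom j))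
    ('D_(delta_mx 0 l) (chart_coord j k \o chart_inv i)).
  exact/smooth_in_partial/chart_transition.
have oD := open_chart_image i' oI.
have DD' : chart i' @` (chart_dom i `&` chart_dom j `&` chart_dom i') `<=`
    (chart i \o chart_inv i') @^-1` (chart i @` (chart_dom i `&` chart_dom j)).
  by move=> _ [q [[iq jq] i'q] <-] /=; exists q => //; rewrite chartK.
apply: smooth_in_eq oD _ (smooth_in_comp _ _ oD DD' _ sx).
  move=> _ /[!inE] -[q [[iq jq] i'q] <-] /=; rewrite chartK // act_coord_vf //.
  exact: smooth_mdiff (smooth_chart_coord j k) jq.
move=> k'; apply: smooth_in_sub (@chart_transition _ _ M i' i k').
by move=> _ [q [[iq jq] i'q] <-]; exists q.
Qed.

End manifold_calculus.

(** * Tensoriality of the covariant derivative of a 1-form *)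

Section tensors.
Context {R : realType} {m : nat} {M : smoothManifold R m}.
Implicit Types (p q : M) (W : set M) (X Y Z : vfield M) (i : chart_index M).

(** Differentiate the identity in the direction X q, factored through the
    chart i. *)
Lemma coord_vf_decomp i X q : chart_dom i q ->
  X q = \sum_k act X (chart_coord i k) q *: coord_vf i k q.
Proof.
move=> iq; have jq := chart_atP q; set j := chart_at q in jq *.
have tr := differentiable_transition _ _ _ iq jq.
transitivity ('D_(X q) (chart j \o chart_inv j) (chart j q)).
  rewrite -[LHS](derive_id (chart j q)); apply: near_eq_derive.
  apply: (@open_near_eq _ _ _ (chart j @` chart_dom j)).
  - exact: (@chart_img_open _ _ M).
  - by exists q.
  - by move=> x; rewrite inE => -[q' jq' <-] /=; rewrite chartK.
rewrite -(near_eq_derive _ (near_transition _ i _ (chart j) jq iq)).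
rewrite derive_comp; last 2 first.
- exact: differentiable_transition.
- by rewrite /= chartK.
rewrite /= chartK // act_coord_vec // derive_sum_delta //.
by apply: eq_bigr => k _; rewrite mxE.
Qed.

Lemma act_chart_at X p k : act X (chart_coord (chart_at p) k) p = X p 0 k.
Proof.
rewrite [in RHS](coord_vf_decomp (chart_at p) X p (chart_atP p)) summxE.
rewrite (bigD1 k) //= coord_vf_at !mxE !eqxx mulr1 big1 ?addr0 // => l lk.
by rewrite coord_vf_at !mxE eq_sym (negbTE lk) andbF mulr0.
Qed.

Lemma ev1D (a : M -> 'cV[R]_m) X Y q : ev1 a (fun q => X q + Y q) q = ev1 a X q + ev1 a Y q.
Proof. by rewrite /ev1 mulmxDl mxE. Qed.

Lemma ev1Z (a : M -> 'cV[R]_m) (f : M -> R) X q : ev1 a (fun q => f q *: X q) q = f q * ev1 a X q.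
Proof. by rewrite /ev1 -scalemxAl mxE. Qed.

End tensors.

Section connection.
Context {R : realType} {m : nat} {M : smoothManifold R m}.
Variable nabla : vfield M -> vfield M -> vfield M.
Hypothesis nabla_affine : affine_connection nabla.
Implicit Types (p q : M) (W : set M) (X Y Z : vfield M).

Lemma smooth_fun_indic W : open W -> smooth_fun W (\1_W : M -> R).
Proof.
move=> oW; apply: smooth_fun_eq oW _ (smooth_fun_cst W 1) => q.
by rewrite indicE => ->.
Qed.

Lemma indic_scale_eq W X Y : {in W, X =1 Y} ->
  (fun q => (\1_W q : R) *: X q) = (fun q => (\1_W q : R) *: Y q).
Proof.
move=> XY; apply/funext => q; rewrite indicE.
by case: (boolP (q \in W)) => [/XY ->|_] //; rewrite !scale0r.
Qed.

(** Fields that agree on W become equal everywhere once multiplied by the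
    indicator function of W, and on W this multiplication does not change the
    connection. *)
Lemma nabla_local W X X' Y Y' p : open W -> W p -> smooth_vf W X -> smooth_vf W Y ->
  {in W, X =1 X'} -> {in W, Y =1 Y'} -> nabla X Y p = nabla X' Y' p.
Proof.
move=> oW Wp sX sY XX' YY'.
have sX' := smooth_vf_eq oW XX' sX; have sY' := smooth_vf_eq oW YY' sY.
have indic1 : (\1_W p : R) = 1 by rewrite indicE mem_set.
have act_indic Z : act Z (\1_W : M -> R) p = 0.
  rewrite (act_eq _ (cst 1) _ _ oW Wp) ?act_cst // => q.
  by rewrite indicE => ->.
have sI := smooth_fun_indic _ oW.
have locX Z Z' : smooth_vf W Z -> smooth_vf W Z' ->
    (fun q => (\1_W q : R) *: Z q) = (fun q => (\1_W q : R) *: Z' q) ->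
    nabla Z Y p = nabla Z' Y p.
  move=> sZ sZ' ZZ'.
  have [_ /(_ _ Wp)[_ e1 _ _]] := nabla_affine W Z Z Y Y _ oW sZ sZ sY sY sI.
  have [_ /(_ _ Wp)[_ e2 _ _]] := nabla_affine W Z' Z' Y Y _ oW sZ' sZ' sY sY sI.
  by rewrite indic1 !scale1r in e1 e2; rewrite -e1 -e2 ZZ'.
have locY Z Z' : smooth_vf W Z -> smooth_vf W Z' ->
    (fun q => (\1_W q : R) *: Z q) = (fun q => (\1_W q : R) *: Z' q) ->
    nabla X' Z p = nabla X' Z' p.
  move=> sZ sZ' ZZ'.
  have [_ /(_ _ Wp)[_ _ _ e1]] := nabla_affine W X' X' Z Z _ oW sX' sX' sZ sZ sI.
  have [_ /(_ _ Wp)[_ _ _ e2]] := nabla_affine W X' X' Z' Z' _ oW sX' sX' sZ' sZ' sI.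
  by rewrite !act_indic indic1 !scale1r !scale0r !add0r in e1 e2; rewrite -e1 -e2 ZZ'.
by rewrite (locX X X') // ?(locY Y Y') //; exact: indic_scale_eq.
Qed.

Variable a : M -> 'cV[R]_m.
Hypothesis smooth_a : smooth_form1 a.

Lemma cov1_local W X X' Y Y' p : open W -> W p -> smooth_vf W X -> smooth_vf W Y ->
  {in W, X =1 X'} -> {in W, Y =1 Y'} -> cov1 nabla X a Y p = cov1 nabla X' a Y' p.
Proof.
move=> oW Wp sX sY XX' YY'.
rewrite /cov1 {2}/ev1 (nabla_local W X X' Y Y') // -/(ev1 a (nabla X' Y') p).
congr (_ - _); rewrite (act_eq _ (ev1 a Y') _ _ oW Wp).
  by rewrite /act XX' // mem_set.
by move=> q Wq; rewrite /ev1 YY'.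
Qed.

Lemma cov1_linX W (f : M -> R) X X' Y p : open W -> W p -> smooth_fun W f ->
  smooth_vf W X -> smooth_vf W X' -> smooth_vf W Y ->
  cov1 nabla (fun q => f q *: X q + X' q) a Y p
    = f p * cov1 nabla X a Y p + cov1 nabla X' a Y p.
Proof.
move=> oW Wp sf sX sX' sY; have sfX := smooth_vfZ _ _ _ oW sf sX.
have [_ /(_ _ Wp)[_ eZ _ _]] := nabla_affine W X X Y Y f oW sX sX sY sY sf.
have [_ /(_ _ Wp)[eD _ _ _]] := nabla_affine W _ X' Y Y f oW sfX sX' sY sY sf.
rewrite /cov1 /ev1 eD eZ mulmxDl mxE -scalemxAl mxE.
rewrite (act_linear _ X X' (f p)) //; first by ring.
exact: smooth_mdiff (smooth_a _ _ oW sY) Wp.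
Qed.

Lemma cov1_linY W (f : M -> R) X Y Y' p : open W -> W p -> smooth_fun W f ->
  smooth_vf W X -> smooth_vf W Y -> smooth_vf W Y' ->
  cov1 nabla X a (fun q => f q *: Y q + Y' q) p
    = f p * cov1 nabla X a Y p + cov1 nabla X a Y' p.
Proof.
move=> oW Wp sf sX sY sY'; have sfY := smooth_vfZ _ _ _ oW sf sY.
have [_ /(_ _ Wp)[_ _ _ eZ]] := nabla_affine W X X Y Y f oW sX sX sY sY sf.
have [_ /(_ _ Wp)[_ _ eD _]] := nabla_affine W X X _ Y' f oW sX sX sfY sY' sf.
rewrite /cov1.
have -> : ev1 a (fun q => f q *: Y q + Y' q) = fun q => f q * ev1 a Y q + ev1 a Y' q.
  by apply/funext => q; rewrite ev1D ev1Z.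
have df := smooth_mdiff sf Wp.
have da := smooth_mdiff (smooth_a _ _ oW sY) Wp.
have da' := smooth_mdiff (smooth_a _ _ oW sY') Wp.
rewrite actD ?actM //; last exact: mdiffM.
rewrite /ev1 eD eZ !mulmxDl -!scalemxAl !mxE; by ring.
Qed.

Lemma cov1_sumX W {I : Type} (r : seq I) (f : I -> M -> R) (X : I -> vfield M) Y p :
  open W -> W p -> (forall k, smooth_fun W (f k)) -> (forall k, smooth_vf W (X k)) ->
  smooth_vf W Y ->
  cov1 nabla (fun q => \sum_(k <- r) f k q *: X k q) a Y p
    = \sum_(k <- r) f k p * cov1 nabla (X k) a Y p.
Proof.
move=> oW Wp sf sX sY; elim: r => [|k r IHr].
  rewrite big_nil; under [in LHS]eq_fun do rewrite big_nil.
  have := cov1_linX W (cst (-1)) (fun=> 0) (fun=> 0) Y p oW Wp (smooth_fun_cst _ _)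
    (smooth_vf0 _) (smooth_vf0 _) sY.
  by under [in LHS]eq_fun do rewrite scaler0 addr0; rewrite mulN1r addNr.
rewrite big_cons -IHr; under [in LHS]eq_fun do rewrite big_cons.
have sS : smooth_vf W (fun q => \sum_(j <- r) f j q *: X j q).
  by apply: smooth_vf_sum => // l; exact: smooth_vfZ.
exact: (cov1_linX W (f k) (X k) _ Y p oW Wp (sf k) (sX k) sS sY).
Qed.

Lemma cov1_sumY W {I : Type} (r : seq I) (f : I -> M -> R) X (Y : I -> vfield M) p :
  open W -> W p -> (forall k, smooth_fun W (f k)) -> (forall k, smooth_vf W (Y k)) ->
  smooth_vf W X ->
  cov1 nabla X a (fun q => \sum_(k <- r) f k q *: Y k q) p
    = \sum_(k <- r) f k p * cov1 nabla X a (Y k) p.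
Proof.
move=> oW Wp sf sY sX; elim: r => [|k r IHr].
  rewrite big_nil; under [in LHS]eq_fun do rewrite big_nil.
  have := cov1_linY W (cst (-1)) X (fun=> 0) (fun=> 0) p oW Wp (smooth_fun_cst _ _) sX
    (smooth_vf0 _) (smooth_vf0 _).
  by under [in LHS]eq_fun do rewrite scaler0 addr0; rewrite mulN1r addNr.
rewrite big_cons -IHr; under [in LHS]eq_fun do rewrite big_cons.
have sS : smooth_vf W (fun q => \sum_(j <- r) f j q *: Y j q).
  by apply: smooth_vf_sum => // l; exact: smooth_vfZ.
exact: (cov1_linY W (f k) X (Y k) _ p oW Wp (sf k) sX (sY k) sS).
Qed.

Definition cov1_mx p : 'M[R]_m :=
  \matrix_(k, l) cov1 nabla (coord_vf (chart_at p) k) a (coord_vf (chart_at p) l) p.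

(** Near p, both fields are combinations of coordinate fields with smooth
    coefficients, and (nabla_X a)(Y) is linear over smooth functions in each
    of them: the derivative of a coefficient of Y cancels between X(a(Y)) and
    a(nabla_X Y). *)
Lemma cov1E W X Y p : open W -> W p -> smooth_vf W X -> smooth_vf W Y ->
  cov1 nabla X a Y p = (X p *m cov1_mx p *m (Y p)^T) 0 0.
Proof.
move=> oW Wp sX sY; set i := chart_at p; have ip : chart_dom i p := chart_atP p.
have oD : open (W `&` chart_dom i) := openI oW (@chart_dom_open _ _ M i).
have WDp : (W `&` chart_dom i) p by [].
have sX' := smooth_vf_sub (@subIsetl _ W (chart_dom i)) sX.
have sY' := smooth_vf_sub (@subIsetl _ W (chart_dom i)) sY.
have sd k := smooth_vf_sub (@subIsetr _ W _) (smooth_coord_vf i k).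
have dec Z : {in W `&` chart_dom i,
    Z =1 fun q => \sum_k act Z (chart_coord i k) q *: coord_vf i k q}.
  by move=> q /[!inE] -[_ iq]; exact: coord_vf_decomp.
have sY2 := smooth_vf_eq oD (dec Y) sY'.
rewrite (cov1_local _ _ _ _ _ p oD WDp sX' sY' (dec X) (dec Y)).
rewrite (cov1_sumX _ _ _ _ _ _ oD WDp (sX i) sd sY2).
rewrite -mulmxA mxE; apply: eq_bigr => k _; rewrite act_chart_at; congr (_ * _).
rewrite (cov1_sumY _ _ _ _ _ _ oD WDp (sY i) sd (sd k)).
by rewrite mxE; apply: eq_bigr => l _; rewrite act_chart_at !mxE mulrC.
Qed.

End connection.

(** * The exterior derivative on an integral manifold *)

Lemma sym_of_add_eq0 {I : Type} {V : zmodType} (S T : I -> I -> V) :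
  (forall b c, S b c + T b c = 0) -> (forall b c, S b c = S c b) ->
  forall b c, T b c = T c b.
Proof.
by move=> ST0 Ssym b c; apply: (addrI (S b c)); rewrite ST0 Ssym ST0.
Qed.

Section exterior_derivative.
Context {R : realType} {m : nat} {M : smoothManifold R m}.

(** Only at p, where the bracket is computed in the chart of these very fields:
    their components in it are constant. *)
Lemma lie_bracket_coord_vf (p : M) k l :
  lie_bracket (coord_vf (chart_at p) k) (coord_vf (chart_at p) l) p = 0.
Proof.
set i := chart_at p; have ip : chart_dom i p := chart_atP p.
have act0 k' l' r : act (coord_vf i k') (act (coord_vf i l') (chart_coord i r)) p = 0.
  have oi := @chart_dom_open _ _ M i.
  rewrite (act_eq _ (cst ((delta_mx 0 l' : 'rV[R]_m) 0 r)) _ _ oi ip) ?act_cst //.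
  move=> q /[!inE] iq; rewrite act_coord_vf //; last first.
    exact: smooth_mdiff (smooth_chart_coord i r) iq.
  rewrite -[in RHS](derive_id (chart i q) (delta_mx 0 l')) derive_row //.
  apply: near_eq_derive.
  apply: (@open_near_eq _ _ _ (chart i @` chart_dom i)).
  - exact: (@chart_img_open _ _ M).
  - by exists q.
  - by move=> x; rewrite inE => -[q' iq' <-]; rewrite /chart_coord /= chartK.
by apply/rowP => r; rewrite mxE !act0 subrr mxE.
Qed.

Variable a : M -> 'cV[R]_m.
Hypothesis smooth_a : smooth_form1 a.

Definition form_coef (i : chart_index M) (l : 'I_m) : M -> R := ev1 a (coord_vf i l).

Lemma smooth_form_coef i l : smooth_fun (chart_dom i) (form_coef i l).
Proof. exact: smooth_a (@chart_dom_open _ _ M i) (smooth_coord_vf i l). Qed.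

Definition d1_mx (p : M) : 'M[R]_m :=
  \matrix_(k, l) d1 a (coord_vf (chart_at p) k) (coord_vf (chart_at p) l) p.

Lemma d1_mxE p k l : d1_mx p k l
  = 'D_(delta_mx 0 k) (form_coef (chart_at p) l \o chart_inv (chart_at p))
      (chart (chart_at p) p)
    - 'D_(delta_mx 0 l) (form_coef (chart_at p) k \o chart_inv (chart_at p))
      (chart (chart_at p) p).
Proof.
have ip := chart_atP p.
rewrite mxE /d1 {3}/ev1 lie_bracket_coord_vf mul0mx [X in _ - X]mxE subr0.
have dc j := smooth_mdiff (smooth_form_coef (chart_at p) j) ip.
by rewrite (act_coord_vf _ _ _ _ ip (dc l)) (act_coord_vf _ _ _ _ ip (dc k)).
Qed.

End exterior_derivative.

Section frobenius.
Context {R : realType} {m : nat} {M : smoothManifold R m.+1}.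
Variable a : M -> 'cV[R]_m.+1.
Hypothesis smooth_a : smooth_form1 a.
Let coef := form_coef a.
Let smooth_coef i l := smooth_form_coef a smooth_a i l.

Section integral_manifold.
Variables (D : set 'rV[R]_m) (h : 'rV[R]_m -> M).
Hypothesis smooth_h : smooth_param D h.
Variable i : chart_index M.

Let D' := D `&` h @^-1` chart_dom i.

Let oD' : open D'.
Proof.
case: smooth_h => oD ch _; rewrite openE => s [Ds ihs].
apply: filterI; first exact: open_nbhs_nbhs.
apply: (ch s Ds); exact: open_nbhs_nbhs (conj (@chart_dom_open _ _ M i) ihs).
Qed.

Let diff_h s : D' s -> differentiable (chart i \o h) s.
Proof.
case: smooth_h => _ _ sh D's; apply: differentiable_rowP => l.
exact: smooth_in_diff (sh i l) D's.
Qed.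

Lemma param_diff_coord s v : D' s ->
  param_diff h s v = \sum_l 'D_v (chart_coord i l \o h) s *: coord_vf i l (h s).
Proof.
move=> D's; have [Ds ihs] := D's; have jhs := chart_atP (h s).
rewrite /param_diff; set j := chart_at (h s) in jhs *.
have tr := differentiable_transition _ _ _ ihs jhs.
have e : {near s, (chart j \o chart_inv i) \o (chart i \o h) =1 chart j \o h}.
  by apply: (open_near_eq oD' D's) => s' /[!inE] -[_ is'] /=; rewrite chartK.
rewrite -(near_eq_derive _ e) derive_comp //; last exact: diff_h.
rewrite derive_sum_delta //; apply: eq_bigr => l _.
by rewrite derive_row //; exact: diff_h.
Qed.

(** With x = h in the chart i and a = sum_l a_l dx^l, the assumption says that
    sum_l (d_c x_l) (a_l o h) = 0 near s for every coordinate direction c.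
    Its derivative along b is the sum of sum_l (d_b d_c x_l) a_l, symmetric in
    b and c, and of sum_(k,l) (d_b x_k) (d_c x_l) (d_k a_l), which therefore is
    symmetric as well. The antisymmetric part of the latter is the pullback of
    d a. *)
Lemma pullback_d1_eq0 s : D' s -> i = chart_at (h s) ->
  (forall s v, D s -> (param_diff h s v *m a (h s)) 0 0 = 0) ->
  forall u v, (param_diff h s u *m d1_mx a (h s) *m (param_diff h s v)^T) 0 0 = 0.
Proof.
move=> D's iE ker_a; have [_ _ sh] := smooth_h; have [Ds ihs] := D's.
pose x l := chart_coord i l \o h.
have dx l : smooth_in D' (x l) := sh i l.
have dc l : differentiable (coef i l \o chart_inv i) (chart i (h s)).
  exact: mdiff_chart ihs (smooth_mdiff (smooth_coef i l) ihs).
have coef_h l : {near s, (coef i l \o chart_inv i) \o (chart i \o h) =1 coef i l \o h}.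
  by apply: (open_near_eq oD' D's) => s' /[!inE] -[_ is'] /=; rewrite chartK.
have dch l : differentiable (coef i l \o h) s.
  apply: near_eq_differentiable (coef_h l) _.
  by apply: differentiable_comp; [exact: diff_h|exact: dc].
pose P u v l k := 'D_u (x k) s * 'D_v (x l) s
  * 'D_(delta_mx 0 k) (coef i l \o chart_inv i) (chart i (h s)).
have Dch l u : 'D_u (coef i l \o h) s
    = \sum_k 'D_u (x k) s * 'D_(delta_mx 0 k) (coef i l \o chart_inv i) (chart i (h s)).
  rewrite -(near_eq_derive _ (coef_h l)) derive_comp; [|exact: diff_h|exact: dc].
  rewrite derive_sum_delta //; apply: eq_bigr => k _.
  by rewrite derive_row //; exact: diff_h.
pose S1 b c := \sum_l 'D_(delta_mx 0 b) ('D_(delta_mx 0 c) (x l)) s * coef i l (h s).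
pose S2 b c := \sum_l \sum_k P (delta_mx 0 b) (delta_mx 0 c) l k.
have deriv_ker b c : S1 b c + S2 b c = 0.
  pose F l := 'D_(delta_mx 0 c) (x l) \* (coef i l \o h).
  have dF1 l : derivable ('D_(delta_mx 0 c) (x l)) s (delta_mx 0 b).
    exact/diff_derivable/(smooth_in_diff (smooth_in_partial c (dx l)) D's).
  have dF2 l : derivable (coef i l \o h) s (delta_mx 0 b) by exact: diff_derivable.
  have dF l : derivable (F l) s (delta_mx 0 b) by exact: derivableM.
  have F0 : {near s, \sum_l F l =1 cst 0}.
    apply: (open_near_eq oD' D's) => s' /[!inE] D's'.
    rewrite fct_sumE -[RHS](ker_a s' (delta_mx 0 c)); last by case: D's'.
    rewrite param_diff_coord // mulmx_suml summxE; apply: eq_bigr => l _.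
    by rewrite -scalemxAl mxE.
  have := near_eq_derive (delta_mx 0 b) F0; rewrite derive_cst derive_sum // => S0.
  rewrite -[RHS]S0 /S1 /S2 -big_split /=; apply: eq_bigr => l _.
  rewrite [RHS](deriveM (dF1 l) (dF2 l)).
  rewrite Dch addrC; congr (_ + _).
    rewrite /GRing.scale /= mulr_sumr; apply: eq_bigr => k _; rewrite /P.
    ring.
  by rewrite /GRing.scale /= mulrC.
have schwarz b c l : 'D_(delta_mx 0 b) ('D_(delta_mx 0 c) (x l)) s
    = 'D_(delta_mx 0 c) ('D_(delta_mx 0 b) (x l)) s.
  apply: derive_comm.
  - have := open_nbhs_nbhs (conj oD' D's); apply: filterS => s' D's'.
    exact: smooth_in_diff (dx l) D's'.
  - exact: smooth_in_diff (smooth_in_partial c (dx l)) D's.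
  - exact: smooth_in_diff (smooth_in_partial b (dx l)) D's.
have S2sym : forall b c, S2 b c = S2 c b.
  apply: sym_of_add_eq0 deriv_ker _ => b c; apply: eq_bigr => l _.
  by rewrite schwarz.
have alg (u v y z : R) : u * ((y - z) * v) = u * v * y - v * u * z by ring.
have basis b c : (param_diff h s (delta_mx 0 b) *m d1_mx a (h s)
    *m (param_diff h s (delta_mx 0 c))^T) 0 0 = 0.
  have pE v l : param_diff h s v 0 l = 'D_v (x l) s.
    have cE l' : coord_vf i l' (h s) = delta_mx 0 l' by rewrite iE coord_vf_at.
    rewrite param_diff_coord // summxE (bigD1 l) //= cE !mxE !eqxx mulr1.
    rewrite big1 ?addr0 // => l' ll'.
    by rewrite cE !mxE eq_sym (negbTE ll') andbF mulr0.
  transitivity (\sum_k \sum_l P (delta_mx 0 b) (delta_mx 0 c) l k - S2 c b).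
    rewrite -sumrB -mulmxA mxE; apply: eq_bigr => k _.
    rewrite mxE mulr_sumr -sumrB; apply: eq_bigr => l _.
    rewrite (d1_mxE a smooth_a) mxE !pE -iE /P.
    exact: alg.
  apply/eqP; rewrite subr_eq0; apply/eqP.
  by rewrite exchange_big; exact: S2sym.
have dh : differentiable (chart (chart_at (h s)) \o h) s by rewrite -iE; exact: diff_h.
have lin v : param_diff h s v = v *m jacobian (chart (chart_at (h s)) \o h) s.
  exact: deriveEjacobian.
set Jh := jacobian _ _ in lin; move=> u v.
set K := d1_mx a (h s) in basis *.
have quad y z : y *m Jh *m K *m (z *m Jh)^T = y *m (Jh *m K *m Jh^T) *m z^T.
  by rewrite trmx_mul !mulmxA.
suff JKJ0 : Jh *m K *m Jh^T = 0 by rewrite !lin quad JKJ0 mulmx0 mul0mx mxE.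
apply/matrixP => b c; rewrite [RHS]mxE -[RHS](basis b c) !lin quad trmx_delta.
by rewrite -rowE -colE !mxE.
Qed.

End integral_manifold.

(** The integral manifold through p has tangent space ker a at p, on which d a
    vanishes by [pullback_d1_eq0]. *)
Lemma integrable_kernel_d1 p (u v : 'rV[R]_m.+1) : integrable_kernel a ->
  (u *m a p) 0 0 = 0 -> (v *m a p) 0 0 = 0 -> (u *m d1_mx a p *m v^T) 0 0 = 0.
Proof.
move=> int_a ua va; have [D [h [s0 [sh Ds0 hs0 _ kerE]]]] := int_a p; subst p.
have [u' <-] := (kerE s0 Ds0 u).2 ua; have [v' <-] := (kerE s0 Ds0 v).2 va.
apply: (pullback_d1_eq0 D h sh (chart_at (h s0))) => //.
  by split=> //; exact: chart_atP.
by move=> s w Ds; apply/(kerE s Ds); exists w.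
Qed.

End frobenius.

(** * Linear algebra of one Hermitian tangent space *)

(** Vectors are rows and covectors columns; J acts on rows from the right. The
    Gram matrix of the metric is G and H is its inverse; e and t stand for the
    values of eta and theta, with metric duals V and U. *)
Section hermitian_plane.
Context {F : numFieldType} {m : nat}.
Variables (J G H : 'M[F]_m) (U V : 'rV[F]_m) (e t : 'cV[F]_m).
Hypotheses (JJ : J *m J = - 1%:M) (Gsym : G^T = G) (JGJ : J *m G *m J^T = G)
  (HG : H *m G = 1%:M) (eE : e = G *m V^T) (tE : t = G *m U^T) (te : t = J *m e)
  (Ut : U *m t = 1%:M).

Let scal0 (x : 'M[F]_1) : x 0 0 = 0 -> x = 0.
Proof. by move=> x0; rewrite [x]mx11_scalar x0 raddf0. Qed.

Let scal_tr (x : 'M[F]_1) : x^T = x.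
Proof. by rewrite [x]mx11_scalar tr_scalar_mx. Qed.

Let skew0 (x : 'M[F]_1) : x = - x^T -> x = 0.
Proof.
rewrite scal_tr => /matrixP/(_ 0 0); rewrite mxE => /eqP.
by rewrite -addr_eq0 -mulr2n mulrn_eq0 /= => /eqP/scal0.
Qed.

Lemma metric_J_skew : J *m G = - (G *m J^T).
Proof.
rewrite -{2}JGJ -(mulmxA _ J^T J^T) -trmx_mul JJ.
by rewrite linearN /= trmx1 mulmxN mulmx1 opprK.
Qed.

Lemma cometricC : G *m H = 1%:M. Proof. exact: mulmx1C HG. Qed.

Lemma cometric_J_skew : H *m J = - (J^T *m H).
Proof.
rewrite -[LHS]mulmx1 -cometricC !mulmxA -(mulmxA H J G) metric_J_skew.
by rewrite mulmxN !mulmxA HG mul1mx mulNmx.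
Qed.

Lemma cometric_sym : H^T = H.
Proof.
by rewrite -[LHS]mulmx1 -cometricC mulmxA -{1}Gsym -trmx_mul cometricC trmx1 mul1mx.
Qed.

Lemma plane_U : U = - (V *m J).
Proof.
have tV : t = - (G *m (V *m J)^T) by rewrite te eE mulmxA metric_J_skew mulNmx -mulmxA -trmx_mul.
by apply: trmx_inj; rewrite -[LHS]mul1mx -HG -mulmxA -tE tV mulmxN mulmxA HG mul1mx linearN.
Qed.

Lemma plane_UJ : U *m J = V.
Proof. by rewrite plane_U mulNmx -mulmxA JJ mulmxN mulmx1 opprK. Qed.

Lemma plane_VJ : V *m J = - U. Proof. by rewrite plane_U opprK. Qed.

Lemma plane_Jt : J *m t = - e.
Proof. by rewrite te mulmxA JJ mulNmx mul1mx. Qed.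

Lemma plane_Ve : V *m e = 1%:M.
Proof. by rewrite -plane_UJ -mulmxA -te. Qed.

Lemma plane_Ue : U *m e = 0.
Proof.
apply: skew0; rewrite eE !trmx_mul trmxK Gsym -{1}plane_UJ -[in RHS]plane_UJ trmx_mul.
by rewrite -(mulmxA U J G) metric_J_skew mulmxN mulNmx opprK !mulmxA.
Qed.

Lemma plane_Vt : V *m t = 0.
Proof. by rewrite te mulmxA plane_VJ mulNmx plane_Ue oppr0. Qed.

Lemma hermitian_plane : [/\ U *m J = V, V *m J = - U, V *m e = 1%:M, U *m e = 0 & V *m t = 0].
Proof.
by split; [exact: plane_UJ|exact: plane_VJ|exact: plane_Ve|exact: plane_Ue|exact: plane_Vt].
Qed.

(** The projection Q along V onto ker e satisfies Q K Q^T = 0, which leaves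
    K = e k - k^T e^T for k = V K. Invariance under J applied to k itself turns
    K(V, .) into a multiple of t, since V J = - U and K(U, .) is a multiple of
    e. *)
Lemma invariant_form_kernel (K : 'M[F]_m) : K^T = - K -> J *m K *m J^T = K ->
  (forall u v : 'rV[F]_m, (u *m e) 0 0 = 0 -> (v *m e) 0 0 = 0 -> (u *m K *m v^T) 0 0 = 0) ->
  K = (V *m K *m U^T) 0 0 *: (e *m t^T - t *m e^T).
Proof.
move=> Kskew JKJ kerK; set c := _ 0 0.
have VKV : V *m K *m V^T = 0.
  by apply: skew0; rewrite !trmx_mul trmxK Kskew mulNmx mulmxN opprK mulmxA.
have [k kE] : exists k, k = V *m K by exists (V *m K).
have KV : K *m V^T = - k^T by rewrite kE trmx_mul Kskew mulNmx opprK.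
have kV : k *m V^T = 0 by rewrite kE VKV.
pose Q := 1%:M - e *m V.
have Qe : Q *m e = 0 by rewrite mulmxBl mul1mx -mulmxA plane_Ve mulmx1 subrr.
have QKQ : Q *m K *m Q^T = 0.
  apply/matrixP => i j; rewrite [RHS]mxE.
  have rowQe l : (row l Q *m e) 0 0 = 0 by rewrite -row_mul Qe row0 mxE.
  rewrite -(kerK _ _ (rowQe i) (rowQe j)) -row_mul [LHS]mxE [RHS]mxE.
  by apply: eq_bigr => l _; rewrite !mxE.
have Kk : K = e *m k - k^T *m e^T.
  move: QKQ; rewrite /Q mulmxBl mul1mx linearB /= trmx1 trmx_mul mulmxBr mulmx1.
  rewrite mulmxBl !mulmxA KV -!(mulmxA e V K) -!kE -(mulmxA e k V^T) kV mulmx0 mul0mx.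
  rewrite subr0 mulNmx opprK => QKQ0; apply/eqP; rewrite -subr_eq0 opprB addrA.
  by apply/eqP; rewrite -[RHS]QKQ0 addrAC.
have kt : k = (U *m k^T) *m t^T.
  have UK : U *m K = - (U *m k^T *m e^T).
    by rewrite {1}Kk mulmxBr !mulmxA plane_Ue mul0mx sub0r.
  rewrite {1}kE -{1}JKJ !mulmxA plane_VJ mulNmx UK opprK.
  by rewrite -(mulmxA (U *m k^T)) -trmx_mul -te.
have kc : k = c *: t^T.
  rewrite {1}kt -[U *m k^T]scal_tr trmx_mul trmxK {1}kE [_ *m U^T]mx11_scalar.
  by rewrite mul_scalar_mx.
by rewrite Kk kc [(c *: _)^T]linearZ /= trmxK -scalemxAr -scalemxAl scalerBr.
Qed.

(** In an orthonormal basis E_k, the trace of A J^T H is the sum of the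
    A(E_k, J E_k). For e /\ t each of the vectors U and V contributes - 1. *)
Lemma trace_dual_plane : \tr ((e *m t^T - t *m e^T) *m J^T *m H) = - 2.
Proof.
have eHe : \tr (e *m e^T *m H) = 1.
  rewrite -mulmxA mxtrace_mulC -mulmxA {2}eE (mulmxA H G) HG mul1mx.
  by rewrite -trmx_mul plane_Ve trmx1 mxtrace1.
have tHt : \tr (t *m t^T *m H) = 1.
  rewrite -mulmxA mxtrace_mulC -mulmxA {2}tE (mulmxA H G) HG mul1mx.
  by rewrite -trmx_mul Ut trmx1 mxtrace1.
rewrite !mulmxBl -!(mulmxA _ _ J^T) -!trmx_mul plane_Jt -te linearN /= mulmxN mulNmx.
by rewrite linearB linearN /= eHe tHt -opprD.
Qed.

(** H J is antisymmetric, so the symmetric part of T has trace zero against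
    J. *)
Lemma trace_skew (T : 'M[F]_m) : \tr ((T - T^T) *m J^T *m H) = \tr (T *m J^T *m H) *+ 2.
Proof.
rewrite !mulmxBl linearB /= mulr2n; congr (_ + _).
rewrite -[RHS]mxtrace_tr !trmx_mul !trmxK cometric_sym mulmxA cometric_J_skew mulNmx linearN.
by rewrite /= [in RHS]mxtrace_mulC mulmxA.
Qed.

End hermitian_plane.

(** * Orthonormal frames *)

Section frames.
Context {R : realType} {m : nat} {M : smoothManifold R m}.
Implicit Types (p q : M) (W : set M) (X Y Z : vfield M).

Lemma mulmx_rows {k l : nat} (A : 'M[R]_(k, m)) (B : 'M[R]_m) (C : 'M[R]_(l, m)) i j :
  (A *m B *m C^T) i j = (row i A *m B *m (row j C)^T) 0 0.
Proof. by rewrite -row_mul [LHS]mxE [RHS]mxE; apply: eq_bigr => r _; rewrite !mxE. Qed.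

Variable g : M -> 'M[R]_m.

Definition frame_mx (E : 'I_m -> vfield M) (q : M) : 'M[R]_m := \matrix_k E k q.

Lemma row_frame_mx E q k : row k (frame_mx E q) = E k q.
Proof. exact: rowK. Qed.

(** The Gram relation F g F^T = 1 of an orthonormal frame, rearranged: F^T F is
    the inverse of g, whatever the frame. This makes the traces below
    independent of the frame. *)
Lemma frame_gram {W E q} : orthonormal_frame g W E -> W q ->
  (frame_mx E q)^T *m frame_mx E q *m g q = 1%:M.
Proof.
move=> [_ onE] Wq.
have FgF : frame_mx E q *m (g q *m (frame_mx E q)^T) = 1%:M.
  rewrite mulmxA; apply/matrixP => i j.
  by rewrite mulmx_rows !row_frame_mx [RHS]mxE -(onE q Wq).
by apply: mulmx1C; rewrite mulmxA; exact: mulmx1C.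
Qed.

Lemma frame_trace (E : 'I_m -> vfield M) q (T B : 'M[R]_m) :
  \sum_k (E k q *m T *m (E k q *m B)^T) 0 0
    = \tr (T *m B^T *m ((frame_mx E q)^T *m frame_mx E q)).
Proof.
transitivity (\tr (frame_mx E q *m T *m (frame_mx E q *m B)^T)).
  by apply: eq_bigr => k _; rewrite [RHS]mulmx_rows row_mul !row_frame_mx.
by rewrite trmx_mul -!mulmxA mxtrace_mulC !mulmxA.
Qed.

(** On W, the dual of a is sum_k a(E_k) E_k; this avoids inverting the metric
    matrix in charts. *)
Lemma smooth_metric_dual W E a A : open W -> orthonormal_frame g W E ->
  (forall p, (g p)^T = g p) -> smooth_form1 a -> metric_dual g a A -> smooth_vf W A.
Proof.
move=> oW onE g_sym sa dual_A; have [sE _] := onE.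
apply: (@smooth_vf_eq _ _ _ W (fun q => \sum_k ev1 a (E k) q *: E k q)) => //.
  move=> q /[!inE] Wq; have FFg := frame_gram onE Wq.
  have gFF := mulmx1C FFg.
  transitivity (A q *m g q *m (frame_mx E q)^T *m frame_mx E q).
    rewrite mulmx_sum_row; apply: eq_bigr => k _; rewrite row_frame_mx; congr (_ *: _).
    by rewrite /ev1 dual_A [RHS]mulmx_rows row_id row_frame_mx.
  by rewrite -!mulmxA gFF mulmx1.
apply: smooth_vf_sum => // k; apply: smooth_vfZ => //.
exact: sa (sE k).
Qed.

End frames.

(** * Exterior and covariant derivatives *)

Section exterior_connection.
Context {R : realType} {m : nat} {M : smoothManifold R m}.
Variables (g : M -> 'M[R]_m) (nabla : vfield M -> vfield M -> vfield M).
Hypothesis nabla_LC : levi_civita g nabla.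
Variable a : M -> 'cV[R]_m.
Hypothesis smooth_a : smooth_form1 a.

Lemma d1_cov1 W X Y p : open W -> W p -> smooth_vf W X -> smooth_vf W Y ->
  d1 a X Y p = cov1 nabla X a Y p - cov1 nabla Y a X p.
Proof.
move=> oW Wp sX sY; have [_ torsion _] := nabla_LC.
have lieE : ev1 a (lie_bracket X Y) p = ev1 a (nabla X Y) p - ev1 a (nabla Y X) p.
  by rewrite /ev1 -(torsion W X Y p oW sX sY Wp) mulmxBl mxE [X in _ + X]mxE.
have alg (u v y z : R) : u - v - (y - z) = u - y - (v - z) by ring.
by rewrite /d1 /cov1 lieE alg.
Qed.

Lemma d1_mx_cov1 p : d1_mx a p = cov1_mx nabla a p - (cov1_mx nabla a p)^T.
Proof.
apply/matrixP => k l; have ip := chart_atP p.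
have sd r := smooth_coord_vf (chart_at p) r.
by rewrite !mxE (d1_cov1 _ _ _ _ (@chart_dom_open _ _ M _) ip (sd k) (sd l)).
Qed.

Lemma d1E W X Y p : open W -> W p -> smooth_vf W X -> smooth_vf W Y ->
  d1 a X Y p = (X p *m d1_mx a p *m (Y p)^T) 0 0.
Proof.
move=> oW Wp sX sY; have [affine _ _] := nabla_LC.
rewrite (d1_cov1 _ _ _ _ oW Wp sX sY) d1_mx_cov1 mulmxBr mulmxBl [RHS]mxE [X in _ = _ + X]mxE.
rewrite (cov1E nabla affine a smooth_a W X Y p oW Wp sX sY).
rewrite (cov1E nabla affine a smooth_a W Y X p oW Wp sY sX).
congr (_ - _); transitivity ((Y p *m cov1_mx nabla a p *m (X p)^T)^T 0 0).
  by rewrite [RHS]mxE.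
by rewrite !trmx_mul trmxK mulmxA.
Qed.

End exterior_connection.

(** * Identities on a locally conformal Kaehler manifold *)

Section lck_identities.
Context {R : realType} {m : nat} {M : smoothManifold R m}.
Variables (J g : M -> 'M[R]_m) (nabla : vfield M -> vfield M -> vfield M)
  (eta theta : M -> 'cV[R]_m) (U V : vfield M).
Hypotheses (hermitian_Jg : hermitian_structure J g) (nabla_LC : levi_civita g nabla)
  (smooth_eta : smooth_form1 eta) (theta_def : theta = lee_form J eta)
  (U_def : metric_dual g theta U) (V_def : metric_dual g eta V)
  (lck_Jg : lck J g eta) (U_unit : forall p, metric_norm g U p = 1).
Implicit Types (p q : M) (W : set M) (X Y Z : vfield M).

Lemma J_sqr p : J p *m J p = - 1%:M.
Proof. by case: hermitian_Jg. Qed.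

Lemma g_sym p : (g p)^T = g p.
Proof. by case: hermitian_Jg => _ _ _ []. Qed.

Lemma JgJ p : J p *m g p *m (J p)^T = g p.
Proof.
have [_ _ _ _ gJ] := hermitian_Jg; apply/matrixP => i j.
have := congr1 (@^~ p) (gJ (fun=> delta_mx 0 i) (fun=> delta_mx 0 j)).
rewrite /ev2 /endo => e; rewrite [LHS]mulmx_rows !rowE e.
by rewrite trmx_delta -rowE -colE !mxE.
Qed.

Lemma metric_dualE (a : M -> 'cV[R]_m) A p :
  metric_dual g a A -> a p = g p *m (A p)^T.
Proof.
move=> dual; apply: trmx_inj; apply/rowP => i; rewrite trmx_mul trmxK g_sym [LHS]mxE.
by have := dual p (delta_mx 0 i); rewrite trmx_delta -rowE -colE !mxE.
Qed.

Lemma etaE p : eta p = g p *m (V p)^T.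
Proof. exact: metric_dualE. Qed.

Lemma thetaE p : theta p = g p *m (U p)^T.
Proof. exact: metric_dualE. Qed.

Lemma theta_unit p : U p *m theta p = 1%:M.
Proof.
have [_ _ _ [_ _ g_pos] _] := hermitian_Jg.
have gU0 : 0 <= ev2 g U U p.
  rewrite /ev2; have [->|/g_pos/ltW//] := eqVneq (U p) 0.
  by rewrite mul0mx mul0mx mxE.
rewrite thetaE mulmxA [LHS]mx11_scalar; congr _%:M.
by rewrite -[LHS](sqr_sqrtr gU0) [Num.sqrt _]U_unit expr1n.
Qed.

Lemma ev1_eta_J X : ev1 eta (endo J X) = ev1 theta X.
Proof. by apply/funext => q; rewrite theta_def /ev1 /endo mulmxA. Qed.

Lemma smooth_theta : smooth_form1 theta.
Proof.
have [sJ _ _ _ _] := hermitian_Jg; move=> W X oW sX.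
by rewrite -ev1_eta_J; exact: smooth_eta (sJ _ _ oW sX).
Qed.

Lemma ev1_theta_J X : ev1 theta (endo J X) = fun q => - ev1 eta X q.
Proof.
by apply/funext => q; rewrite -ev1_eta_J /ev1 /endo -(mulmxA (X q)) J_sqr mulmxN mulmx1 mulNmx mxE.
Qed.

Lemma nijenhuis_eta (A B C D : vfield M) p :
  A p - endo J B p - endo J C p - D p = 0 ->
  ev1 eta A p = ev1 theta B p + ev1 theta C p + ev1 eta D p.
Proof.
move=> /eqP; rewrite subr_eq0 subr_eq subr_eq => /eqP Ap.
by rewrite -!ev1_eta_J /ev1 Ap !mulmxDl [LHS]mxE [X in X + _]mxE; ring.
Qed.

Lemma d1_theta_eq0 W X Y p : open W -> W p -> smooth_vf W X -> smooth_vf W Y ->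
  d1 theta X Y p = 0.
Proof.
by move=> oW Wp sX sY; have [_] := lck_Jg W X Y X p oW sX sY sX Wp; rewrite theta_def.
Qed.

(** The vanishing of N(X, Y) expresses eta([J X, J Y]) - eta([X, Y]) through
    theta([J X, Y]) and theta([X, J Y]). Adding d theta (J X, Y) = 0 and
    d theta (X, J Y) = 0, where theta o J = - eta, gives the claim. *)
Lemma d1_eta_J W X Y p : open W -> W p -> smooth_vf W X -> smooth_vf W Y ->
  d1 eta (endo J X) (endo J Y) p = d1 eta X Y p.
Proof.
have alg (u v z u' v' z' w : R) : u + v - z = 0 -> - u' - v' - z' = 0 ->
  u - v' - (z + z' + w) = u' - v - w by lra.
have [sJ _ nij _ _] := hermitian_Jg; move=> oW Wp sX sY.
have sJX := sJ _ _ oW sX; have sJY := sJ _ _ oW sY.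
have dt1 := d1_theta_eq0 W _ _ p oW Wp sJX sY.
have dt2 := d1_theta_eq0 W _ _ p oW Wp sX sJY.
have dX := smooth_mdiff (smooth_eta _ _ oW sX) Wp.
have dY := smooth_mdiff (smooth_eta _ _ oW sY) Wp.
have lie_eta := nijenhuis_eta _ _ _ _ p (nij W X Y p oW sX sY Wp).
have {}dt1 : act (endo J X) (ev1 theta Y) p + act Y (ev1 eta X) p
    - ev1 theta (lie_bracket (endo J X) Y) p = 0.
  by rewrite -dt1 /d1 (ev1_theta_J X) (actN _ _ _ dX) opprK.
have {}dt2 : - act X (ev1 eta Y) p - act (endo J Y) (ev1 theta X) p
    - ev1 theta (lie_bracket X (endo J Y)) p = 0.
  by rewrite -dt2 /d1 (ev1_theta_J Y) (actN _ _ _ dY).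
have e1 := congr1 (fun f => act (endo J X) f p) (ev1_eta_J Y).
have e2 := congr1 (fun f => act (endo J Y) f p) (ev1_eta_J X).
have sub3 (u u' v v' z z' : R) : u = u' -> v = v' -> z = z' -> u - v - z = u' - v' - z'.
  by move=> -> -> ->.
exact: etrans (sub3 _ _ _ _ _ _ e1 e2 lie_eta) (alg _ _ _ _ _ _ _ dt1 dt2).
Qed.

End lck_identities.

Section lck_consequences.
Context {R : realType} {m : nat} {M : smoothManifold R m}.
Variables (J g : M -> 'M[R]_m) (nabla : vfield M -> vfield M -> vfield M)
  (eta theta : M -> 'cV[R]_m) (U V : vfield M).
Hypotheses (hermitian_Jg : hermitian_structure J g) (nabla_LC : levi_civita g nabla)
  (smooth_eta : smooth_form1 eta) (theta_def : theta = lee_form J eta)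
  (U_def : metric_dual g theta U) (V_def : metric_dual g eta V)
  (lck_Jg : lck J g eta) (U_unit : forall p, metric_norm g U p = 1).
Implicit Types (p q : M) (W : set M) (X Y Z : vfield M).

Local Notation Omega := (fundamental_form J g).

Lemma invmx_metric p : invmx (g p) *m g p = 1%:M.
Proof.
have [_ _ _ [_ _ g_pos] _] := hermitian_Jg.
apply: mulVmx; rewrite -row_free_unit -kermx_eq0; apply/eqP/row_matrixP => i.
rewrite row0; apply/eqP; apply: contraT => /(g_pos p).
by rewrite -row_mul mulmx_ker row0 mul0mx mxE ltxx.
Qed.

Let gsym p : (g p)^T = g p := g_sym J g hermitian_Jg p.
Let eE p := etaE J g eta V hermitian_Jg V_def p.
Let tE p := thetaE J g theta U hermitian_Jg U_def p.
Let te p : theta p = J p *m eta p. Proof. by rewrite theta_def. Qed.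
Let Ut p := theta_unit J g theta U hermitian_Jg U_def U_unit p.

Lemma lee_plane p : [/\ U p *m J p = V p, V p *m J p = - U p, V p *m eta p = 1%:M,
  U p *m eta p = 0 & V p *m theta p = 0].
Proof.
exact: (@hermitian_plane _ _ _ _ _ _ _ _ _ (J_sqr J g hermitian_Jg p) (gsym p)
  (JgJ J g hermitian_Jg p) (invmx_metric p) (eE p) (tE p) (te p) (Ut p)).
Qed.

Lemma mxE_tr (x : 'M[R]_1) : x^T 0 0 = x 0 0.
Proof. by rewrite mxE. Qed.

Lemma Omega_V X : ev2 Omega X V = fun q => - ev1 theta X q.
Proof.
apply/funext => q; have [_ VJ _ _ _] := lee_plane q.
rewrite /ev2 /fundamental_form /ev1 tE !mulmxA -(mulmxA _ (J q)^T) -trmx_mul VJ.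
by rewrite linearN /= mulmxN mxE.
Qed.

Lemma Omega_U X : ev2 Omega X U = ev1 eta X.
Proof.
apply/funext => q; have [UJ _ _ _ _] := lee_plane q.
by rewrite /ev2 /fundamental_form /ev1 eE !mulmxA -(mulmxA _ (J q)^T) -trmx_mul UJ.
Qed.

Lemma V_Omega Z : ev2 Omega V Z = ev1 theta Z.
Proof.
apply/funext => q; rewrite -(ev1_eta_J J eta theta theta_def) /ev2 /fundamental_form /ev1 /endo.
by rewrite -[LHS]mxE_tr eE !trmx_mul !trmxK gsym !mulmxA.
Qed.

Lemma Omega_J X Y : ev2 Omega X Y = fun q => - ev2 g Y (endo J X) q.
Proof.
apply/funext => q; have Jg := metric_J_skew _ _ (J_sqr J g hermitian_Jg q) (JgJ J g hermitian_Jg q).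
rewrite /ev2 /fundamental_form /endo -[g q *m (J q)^T]opprK -Jg mulmxN mulNmx [LHS]mxE.
by congr (- _); rewrite -[LHS]mxE_tr !trmx_mul trmxK gsym !mulmxA.
Qed.

Lemma cov1_eta W X Z p : open W -> W p -> smooth_vf W X -> smooth_vf W V -> smooth_vf W Z ->
  cov1 nabla X eta Z p = ev2 g (nabla X V) Z p.
Proof.
move=> oW Wp sX sV sZ; have [_ _ compat] := nabla_LC.
have eta_g Z' : ev1 eta Z' = ev2 g V Z' by apply/funext => q; rewrite /ev1 V_def.
rewrite /cov1 eta_g (compat W X V Z p oW sX sV sZ Wp).
by rewrite -[ev1 _ _ _](congr1 (@^~ p) (esym (eta_g (nabla X Z)))) addrK.
Qed.

(** Omega(Y, V) = - theta(Y) and Omega(Y, nabla_X V) = - g(nabla_X V, J Y),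
    where g(nabla_X V, .) = nabla_X eta. *)
Lemma cov2_Omega_V W X Y p : open W -> W p -> smooth_vf W X -> smooth_vf W Y -> smooth_vf W V ->
  cov2 nabla X Omega Y V p = cov1 nabla X eta (endo J Y) p - cov1 nabla X theta Y p.
Proof.
move=> oW Wp sX sY sV; have [sJ _ _ _ _] := hermitian_Jg.
have alg (u v y : R) : - u - (- v) - (- y) = y - (u - v) by ring.
have sth := smooth_theta J g eta theta hermitian_Jg smooth_eta theta_def.
rewrite (cov1_eta W X (endo J Y) p oW Wp sX sV (sJ _ _ oW sY)).
have e1 := congr1 (fun f => act X f p) (Omega_V Y).
have e2 := congr1 (@^~ p) (Omega_V (nabla X Y)).
have e3 := congr1 (@^~ p) (Omega_J Y (nabla X V)).
have e4 := actN _ X p (smooth_mdiff (sth _ _ oW sY) Wp).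
have sub3 (u u' v v' z z' : R) : u = u' -> v = v' -> z = z' -> u - v - z = u' - v' - z'.
  by move=> -> -> ->.
exact: etrans (sub3 _ _ _ _ _ _ (etrans e1 e4) e2 e3) (alg _ _ _).
Qed.

Lemma codiff2_Omega_V W E p : open W -> W p -> orthonormal_frame g W E -> smooth_vf W V ->
  - (\sum_k cov2 nabla (E k) Omega (E k) V p)
    = \tr (cov1_mx nabla theta p *m ((frame_mx E p)^T *m frame_mx E p))
      - \tr (cov1_mx nabla eta p *m (J p)^T *m ((frame_mx E p)^T *m frame_mx E p)).
Proof.
move=> oW Wp onE sV; have [sE _] := onE; have [sJ _ _ _ _] := hermitian_Jg.
have [affine _ _] := nabla_LC.
have sth := smooth_theta J g eta theta hermitian_Jg smooth_eta theta_def.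
have := frame_trace E p (cov1_mx nabla theta p) 1%:M; rewrite trmx1 mulmx1 => <-.
rewrite -(frame_trace E p (cov1_mx nabla eta p) (J p)) -sumrB -sumrN.
apply: eq_bigr => k _; have sk := sE k.
rewrite (cov2_Omega_V W _ _ p oW Wp sk sk sV) opprB mulmx1.
by rewrite (cov1E nabla affine theta sth W _ _ p oW Wp sk sk)
  (cov1E nabla affine eta smooth_eta W _ _ p oW Wp sk (sJ _ _ oW sk)).
Qed.

Lemma d1_mx_eta_J p : J p *m d1_mx eta p *m (J p)^T = d1_mx eta p.
Proof.
have [sJ _ _ _ _] := hermitian_Jg.
have oi := @chart_dom_open _ _ M (chart_at p); have ip := chart_atP p.
apply/matrixP => k l; have sk := smooth_coord_vf (chart_at p) k.
have sl := smooth_coord_vf (chart_at p) l.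
rewrite [RHS]mxE.
rewrite -(d1_eta_J J g eta theta hermitian_Jg smooth_eta theta_def lck_Jg _ _ _ p oi ip sk sl).
rewrite (d1E g nabla nabla_LC eta smooth_eta _ _ _ p oi ip (sJ _ _ oi sk) (sJ _ _ oi sl)).
by rewrite /endo !coord_vf_at -!rowE [LHS]mulmx_rows.
Qed.

(** This is d Omega = theta /\ Omega on U, V and Z: the terms of d Omega other
    than Omega([U, V], Z) are those of d theta (Z, U) and d eta (V, Z), and
    (theta /\ Omega)(U, V, Z) = 0. *)
Lemma lie_bracket_UV W Z p (c : R) : open W -> W p ->
  smooth_vf W U -> smooth_vf W V -> smooth_vf W Z ->
  d1 eta V Z p = c * ev1 theta Z p -> ev2 Omega (lie_bracket U V) Z p = c * ev1 theta Z p.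
Proof.
have alg (a1 a2 a3 x y z u v t : R) : a1 + a2 + a3 - x - y - (- z) = 0 -> a3 = 0 ->
  u - a1 - z = 0 -> u = 0 -> a2 - v - y = t -> v = 0 -> x = t by lra.
move=> oW Wp sU sV sZ dVZ.
have [d2UVZ _] := lck_Jg W U V Z p oW sU sV sZ Wp.
have thU : ev1 theta U = cst 1 by apply/funext => q; rewrite /ev1 Ut mxE.
have etV : ev1 eta V = cst 1.
  by apply/funext => q; have [_ _ Ve _ _] := lee_plane q; rewrite /ev1 Ve mxE.
have OUV : ev2 Omega U V = cst (-1).
  by rewrite Omega_V; apply/funext => q; rewrite thU.
have thV : ev1 theta V p = 0.
  by have [_ _ _ _ Vt] := lee_plane p; rewrite /ev1 Vt mxE.
have act_cst0 X (f : M -> R) r : f = cst r -> act X f p = 0.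
  by move=> ->; exact: act_cst.
have w0 : wedge12 (lee_form J eta) Omega U V Z p = 0.
  rewrite -theta_def /wedge12 thV mul0r addr0 (congr1 (@^~ p) OUV) (congr1 (@^~ p) thU).
  by rewrite (congr1 (@^~ p) (V_Omega Z)) mul1r mulrN1 subrr.
have e1 := congr1 (fun f => act U f p) (V_Omega Z).
have e2 := congr1 (fun f => act V f p) (Omega_U Z).
have e3 := congr1 (@^~ p) (Omega_U (lie_bracket V Z)).
have e4 := congr1 (@^~ p) (Omega_V (lie_bracket Z U)).
have sum6 (u u' v v' w z z' y y' x : R) : u = u' -> v = v' -> z = z' -> y = y' ->
    u + v + w - x - z - y = u' + v' + w - x - z' - y' by move=> -> -> -> ->.
have d2E : d2 Omega U V Z p = act U (ev1 theta Z) p + act V (ev1 eta Z) p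
    + act Z (ev2 Omega U V) p - ev2 Omega (lie_bracket U V) Z p
    - ev1 eta (lie_bracket V Z) p - - ev1 theta (lie_bracket Z U) p.
  exact: sum6 e1 e2 e3 e4.
have d1ZU : act Z (ev1 theta U) p - act U (ev1 theta Z) p
    - ev1 theta (lie_bracket Z U) p = 0.
  exact: d1_theta_eq0 J g eta theta theta_def lck_Jg W Z U p oW Wp sZ sU.
have d1VZ : act V (ev1 eta Z) p - act Z (ev1 eta V) p
    - ev1 eta (lie_bracket V Z) p = c * ev1 theta Z p := dVZ.
apply: (alg _ _ _ _ _ _ _ _ _ (etrans (esym d2E) (etrans d2UVZ w0)) _ d1ZU _ d1VZ _).
- exact: act_cst0 OUV.
- exact: act_cst0 thU.
- exact: act_cst0 etV.
Qed.

End lck_consequences.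

(** * The factor of d eta and the bracket *)

Lemma wedge_mxE {R : realType} {m : nat} (u v : 'rV[R]_m) (a b : 'cV[R]_m) :
  (u *m (a *m b^T - b *m a^T) *m v^T) 0 0
    = (u *m a) 0 0 * (v *m b) 0 0 - (v *m a) 0 0 * (u *m b) 0 0.
Proof.
have prod (c d : 'cV[R]_m) : (u *m (c *m d^T) *m v^T) 0 0 = (u *m c) 0 0 * (v *m d) 0 0.
  by rewrite mulmxA -mulmxA -trmx_mul mxE big_ord1 [_^T _ _]mxE.
rewrite mulmxBr mulmxBl [LHS]mxE [X in _ + X]mxE !prod; congr (_ - _).
exact: mulrC.
Qed.

(** That d eta is a multiple of eta /\ theta is [invariant_form_kernel]; the
    multiple is found by comparing two values of the trace of d eta against J,
    one from n eta = delta Omega and delta theta = 0, one from the shape of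
    d eta. *)
Lemma d1_mx_anti_lee {R : realType} {n : nat} {M : smoothManifold R n.*2.+2}
    (J g : M -> 'M[R]_(n.*2.+2)) (nabla : vfield M -> vfield M -> vfield M)
    (eta theta : M -> 'cV[R]_(n.*2.+2)) (U V : vfield M) (deltaOmega : M -> 'cV[R]_(n.*2.+2))
    (hermitian_Jg : hermitian_structure J g) (nabla_LC : levi_civita g nabla)
    (smooth_eta : smooth_form1 eta)
    (deltaP : codiff2 g nabla (fundamental_form J g) deltaOmega)
    (deltaE : forall p, deltaOmega p = n%:R *: eta p)
    (theta_def : theta = lee_form J eta)
    (U_def : metric_dual g theta U) (V_def : metric_dual g eta V) (lck_Jg : lck J g eta)
    (ker_eta_integrable : integrable_kernel eta)
    (gauduchon : codiff1 g nabla theta (fun=> 0))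
    (U_unit : forall p, metric_norm g U p = 1) p :
  d1_mx eta p = n%:R *: (eta p *m (theta p)^T - theta p *m (eta p)^T).
Proof.
have [affine _ _] := nabla_LC.
have sth := smooth_theta J g eta theta hermitian_Jg smooth_eta theta_def.
have [W [E [oW Wp onE delE]]] := deltaP p.
have sV := smooth_metric_dual g W E eta V oW onE (g_sym J g hermitian_Jg) smooth_eta V_def.
have [W' [E' [oW' Wp' onE' gauE]]] := gauduchon p.
have HG := frame_gram g onE Wp.
pose H := (frame_mx E p)^T *m frame_mx E p.
have [_ _ Ve _ _] := lee_plane J g eta theta U V hermitian_Jg theta_def U_def V_def U_unit p.
have eE := etaE J g eta V hermitian_Jg V_def p.
have tE := thetaE J g theta U hermitian_Jg U_def p.
have te : theta p = J p *m eta p by rewrite theta_def.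
have Ut := theta_unit J g theta U hermitian_Jg U_def U_unit p.
have JJp := J_sqr J g hermitian_Jg p; have JgJp := JgJ J g hermitian_Jg p.
have gsym := g_sym J g hermitian_Jg p.
have Kskew : (d1_mx eta p)^T = - d1_mx eta p.
  by rewrite (d1_mx_cov1 g nabla nabla_LC) linearB /= trmxK opprB.
have KJ := d1_mx_eta_J J g nabla eta theta hermitian_Jg nabla_LC smooth_eta theta_def lck_Jg p.
have kerK u v := integrable_kernel_d1 eta smooth_eta p u v ker_eta_integrable.
have := invariant_form_kernel _ _ _ _ _ _ _ JJp gsym JgJp HG eE tE te Ut _ Kskew KJ kerK.
set c := _ 0 0 => KE; rewrite KE; congr (_ *: _).
(* The frame E' in which delta theta is given may differ from E, but both
   compute the trace against the inverse of g. *)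
have trS : \tr (cov1_mx nabla theta p *m H) = 0.
  have HG' := frame_gram g onE' Wp'.
  have -> : H = (frame_mx E' p)^T *m frame_mx E' p.
    by rewrite -[RHS]mulmx1 -(mulmx1C HG) mulmxA HG' mul1mx.
  have := frame_trace E' p (cov1_mx nabla theta p) 1%:M; rewrite trmx1 mulmx1 => <-.
  have [sE' _] := onE'; apply: oppr_inj; rewrite oppr0.
  apply: etrans (esym (gauE p Wp')); congr (- _); apply: eq_bigr => k _; rewrite mulmx1.
  by rewrite (cov1E nabla affine theta sth W' _ _ p oW' Wp' (sE' k) (sE' k)).
have trT : \tr (cov1_mx nabla eta p *m (J p)^T *m H) = - n%:R.
  have := codiff2_Omega_V J g nabla eta theta U V hermitian_Jg nabla_LC smooth_eta
    theta_def U_def V_def U_unit W E p oW Wp onE sV.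
  rewrite -(delE W V p oW (@subset_refl _ W) sV Wp) -/H trS sub0r.
  rewrite /ev1 deltaE -scalemxAr Ve !mxE eqxx mulr1 => nE.
  by rewrite nE opprK.
have : \tr (d1_mx eta p *m (J p)^T *m H) = c * - 2.
  rewrite KE -!scalemxAl linearZ /=; congr (_ * _).
  exact: (trace_dual_plane _ _ _ _ _ _ _ JJp JgJp HG eE tE te Ut).
rewrite (d1_mx_cov1 g nabla nabla_LC) (trace_skew _ _ _ JJp gsym JgJp HG) trT.
by move=> ?; lra.
Qed.

Theorem corollary3p5 (R : realType) (n : nat) (n_ge1 : (1 <= n)%N)
    (M : smoothManifold R n.*2.+2) (J g : M -> 'M[R]_(n.*2.+2))
    (nabla : vfield M -> vfield M -> vfield M)
    (eta theta : M -> 'cV[R]_(n.*2.+2)) (U V : vfield M)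
    (hermitian_Jg : hermitian_structure J g)
    (nabla_LC : levi_civita g nabla)
    (eta_def : anti_lee_form J g nabla eta)
    (theta_def : theta = lee_form J eta)
    (U_def : metric_dual g theta U)
    (V_def : metric_dual g eta V)
    (lck_Jg : lck J g eta)
    (V_neq0 : forall p, V p != 0)
    (ker_eta_integrable : integrable_kernel eta)
    (gauduchon : codiff1 g nabla theta (fun=> 0))
    (theta_norm1 : forall p, metric_norm g U p = 1) :
  (forall (W : set M) (X Y : vfield M) (p : M),
     open W -> smooth_vf W X -> smooth_vf W Y -> W p ->
     d1 eta X Y p = n%:R * wedge11 eta theta X Y p) /\
  (forall p : M, lie_bracket U V p = n%:R *: V p).
Proof.
have [deltaOmega [s_delta deltaP eta_delta]] := eta_def.
have n0 : n%:R != 0 :> R by rewrite pnatr_eq0 -lt0n.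
have deltaE p : deltaOmega p = n%:R *: eta p by rewrite eta_delta scalerA divff ?scale1r.
have smooth_eta : smooth_form1 eta.
  move=> W X oW sX; rewrite (_ : ev1 eta X = fun q => cst n%:R^-1 q * ev1 deltaOmega X q).
    by apply: smooth_funM (s_delta _ _ oW sX) => //; exact: smooth_fun_cst.
  by apply/funext => q; rewrite /ev1 eta_delta -scalemxAr mxE.
have K p := d1_mx_anti_lee J g nabla eta theta U V deltaOmega hermitian_Jg nabla_LC smooth_eta
  deltaP deltaE theta_def U_def V_def lck_Jg ker_eta_integrable gauduchon theta_norm1 p.
have d_eta (W : set M) (X Y : vfield M) (p : M) : open W -> smooth_vf W X -> smooth_vf W Y -> W p ->
     d1 eta X Y p = n%:R * wedge11 eta theta X Y p.
  move=> oW sX sY Wp; rewrite (d1E g nabla nabla_LC eta smooth_eta W _ _ p oW Wp sX sY) K.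
  by rewrite -scalemxAr -scalemxAl mxE wedge_mxE.
split=> // p.
have gsym := g_sym J g hermitian_Jg.
have sth := smooth_theta J g eta theta hermitian_Jg smooth_eta theta_def.
have [W [E [oW Wp onE _]]] := deltaP p; have [sE _] := onE.
have sV := smooth_metric_dual g W E eta V oW onE gsym smooth_eta V_def.
have sU := smooth_metric_dual g W E theta U oW onE gsym sth U_def.
have [_ _ Ve _ Vt] := lee_plane J g eta theta U V hermitian_Jg theta_def U_def V_def theta_norm1 p.
have Omega_UV k : ev2 (fundamental_form J g) (lie_bracket U V) (E k) p
    = n%:R * ev1 theta (E k) p.
  apply: (lie_bracket_UV J g eta theta U V hermitian_Jg theta_def U_def V_def lck_Jg theta_norm1
    W _ p _ oW Wp sU sV (sE k)).
  rewrite (d_eta W V (E k) p oW sV (sE k) Wp) /wedge11 /ev1 Ve Vt !mxE eqxx.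
  by rewrite mul1r mulr0 subr0.
have VO k := congr1 (@^~ p) (V_Omega J g eta theta V hermitian_Jg theta_def V_def (E k)).
pose x := lie_bracket U V p - n%:R *: V p.
have xF : x *m fundamental_form J g p *m (frame_mx E p)^T = 0.
  apply/rowP => k; rewrite [RHS]mxE mulmx_rows row_id row_frame_mx.
  rewrite /x !mulmxBl -!scalemxAl [LHS]mxE [X in _ + X]mxE [X in _ - X]mxE.
  apply/eqP; rewrite subr_eq0; apply/eqP; apply: etrans (Omega_UV k) _.
  by congr (_ * _); rewrite -VO.
apply/eqP; rewrite -subr_eq0 -/x; apply/eqP.
(* The nondegeneracy of Omega: g, J and the frame are invertible. *)
have HG := frame_gram g onE Wp.
have FF : (frame_mx E p)^T *m (frame_mx E p *m g p) = 1%:M by rewrite mulmxA.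
have JJp := J_sqr J g hermitian_Jg p; have JgJp := JgJ J g hermitian_Jg p.
have : x *m fundamental_form J g p *m (frame_mx E p)^T *m (frame_mx E p *m g p) = 0.
  by rewrite xF mul0mx.
rewrite -(mulmxA _ (_^T)) FF mulmx1 /fundamental_form => xgJ.
have gJx : x *m J p *m g p = 0.
  by rewrite -mulmxA (metric_J_skew _ _ JJp JgJp) mulmxN xgJ oppr0.
have xJ : x *m J p = 0 by rewrite -[LHS]mulmx1 -(mulmx1C HG) mulmxA gJx mul0mx.
by rewrite -[x]mulmx1 -[1%:M]opprK -JJp mulmxN mulmxA xJ mul0mx oppr0.
Qed.
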